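(* Let $n\ge 1$ be an integer. Every unit weighing matrix $UW(n,4)$ is equivalent to a block diagonal matrix (a direct sum) each of whose diagonal blocks is one of $W_5$, $W_6$, $W_7$, $W_8$, or $E_{2m}(x)$ for some integer $m$ with $2\le m\le n/2$ and some unimodular number $x\in\mathbb{T}$ (where $m$ and $x$ may vary from block to block).
   Context: $\mathbb{T}$ is the set of complex numbers of absolute value one (unimodular numbers). A unit weighing matrix $UW(n,p)$ is an $n\times n$ matrix $W$ with entries in $\mathbb{T}\cup\{0\}$ such that $WW^*=pI_n$, where $^*$ is the Hermitian transpose. Two unit weighing matrices are equivalent if one can be obtained from the other by a finite sequence of the operations: permuting rows, permuting columns, multiplying a row by an element of $\mathbb{T}$, multiplying a column by an element of $\mathbb{T}$. In matrices, $-$ denotes $-1$. Put $a=e^{2\pi i/3}$ and let $$W_5=\begin{pmatrix}1&1&1&1&0\\1&a&\overline a&0&1\\1&\overline a&0&a&\overline a\\1&0&a&\overline a&a\\0&1&\overline a&a&a\end{pmatrix},\quad W_6=\begin{pmatrix}1&1&1&1&0&0\\1&a&\overline a&0&1&0\\1&\overline a&a&0&0&1\\1&0&0&-&-&-\\0&1&0&-&-\overline a&-a\\0&0&1&-&-a&-\overline a\end{pmatrix},$$ $$W_7=\begin{pmatrix}1&1&1&1&0&0&0\\1&-&0&0&1&1&0\\1&0&-&0&-&0&1\\1&0&0&-&0&-&-\\0&1&-&0&0&1&-\\0&1&0&-&1&0&1\\0&0&1&-&-&1&0\end{pmatrix},\quad W_8=\begin{pmatrix}1&1&1&1&0&0&0&0\\1&-&0&0&1&1&0&0\\1&0&-&0&-&0&1&0\\1&0&0&-&0&-&-&0\\0&1&-&0&1&0&0&1\\0&1&0&-&0&1&0&-\\0&0&1&-&0&0&1&1\\0&0&0&0&1&-&1&-\end{pmatrix}.$$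 For $m\ge 2$ and $x\in\mathbb{T}$, $E_{2m}(x)$ is the $2m\times 2m$ matrix which, partitioned into an $m\times m$ array of $2\times2$ blocks $B_{i,j}$, has $$B_{1,1}=\begin{pmatrix}1&1\\1&1\end{pmatrix},\quad B_{i,i+1}=\begin{pmatrix}1&1\\-&-\end{pmatrix}\ (1\le i\le m-1),\quad B_{i+1,i}=\begin{pmatrix}1&-\\1&-\end{pmatrix}\ (1\le i\le m-1),\quad B_{m,m}=\begin{pmatrix}x&-x\\-x&x\end{pmatrix},$$ and all other blocks equal to zero. For example $E_4(x)=\begin{pmatrix}1&1&1&1\\1&1&-&-\\1&-&x&-x\\1&-&-x&x\end{pmatrix}$. *)

(* Defs.v *)
From HB Require Import structures.
From mathcomp Require Import all_boot all_order all_algebra all_fingroup.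
From mathcomp Require Import spectral.
From mathcomp Require Import reals trigo.
From mathcomp Require Export complex.

Set Implicit Arguments.
Unset Strict Implicit.
Unset Printing Implicit Defensive.

Import Order.TTheory GRing.Theory Num.Theory.
Local Open Scope ring_scope.
Local Open Scope sesquilinear_scope.

(* The field of complex numbers is R[i] for R : realType. *)

Definition unimodular (R : realType) (x : R[i]) : bool := `|x| == 1.

(* [M ^t*] is the Hermitian transpose of M. *)
Definition unit_weighing (R : realType) (n p : nat) (W : 'M[R[i]]_n) : Prop :=
  (forall i j, unimodular (W i j) \/ W i j = 0) /\ W *m W ^t* = (p%:R)%:M.

Definition scale_row (R : realType) (n : nat) (k : 'I_n) (c : R[i])
    (A : 'M[R[i]]_n) : 'M[R[i]]_n :=
  \matrix_(i, j) ((if i == k then c else 1) * A i j).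

Definition scale_col (R : realType) (n : nat) (k : 'I_n) (c : R[i])
    (A : 'M[R[i]]_n) : 'M[R[i]]_n :=
  \matrix_(i, j) (A i j * (if j == k then c else 1)).

Inductive uw_equiv (R : realType) (n : nat) (A : 'M[R[i]]_n) :
    'M[R[i]]_n -> Prop :=
| uw_refl : uw_equiv A A
| uw_row_perm B (s : 'S_n) : uw_equiv A B -> uw_equiv A (row_perm s B)
| uw_col_perm B (s : 'S_n) : uw_equiv A B -> uw_equiv A (col_perm s B)
| uw_scale_row B (k : 'I_n) (c : R[i]) :
    unimodular c -> uw_equiv A B -> uw_equiv A (scale_row k c B)
| uw_scale_col B (k : 'I_n) (c : R[i]) :
    unimodular c -> uw_equiv A B -> uw_equiv A (scale_col k c B).

Definition mx_of_rows (R : realType) (n : nat) (rows : seq (seq R[i])) :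
    'M[R[i]]_n :=
  \matrix_(i, j) nth 0 (nth [::] rows i) j.

(* exp (2 i pi / 3), in Cartesian form *)
Definition omega (R : realType) : R[i] :=
  Complex (cos (2 * pi / 3)) (sin (2 * pi / 3)).

Definition W5 (R : realType) : 'M[R[i]]_5 :=
  let a := omega R in
  mx_of_rows 5
    [:: [:: 1; 1;   1;   1;   0];
        [:: 1; a;   a^*; 0;   1];
        [:: 1; a^*; 0;   a;   a^*];
        [:: 1; 0;   a;   a^*; a];
        [:: 0; 1;   a^*; a;   a]].

Definition W6 (R : realType) : 'M[R[i]]_6 :=
  let a := omega R in
  mx_of_rows 6
    [:: [:: 1; 1;   1;   1;  0;     0];
        [:: 1; a;   a^*; 0;  1;     0];
        [:: 1; a^*; a;   0;  0;     1];
        [:: 1; 0;   0;   -1; -1;    -1];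
        [:: 0; 1;   0;   -1; - a^*; - a];
        [:: 0; 0;   1;   -1; - a;   - a^*]].

Definition W7 (R : realType) : 'M[R[i]]_7 :=
  mx_of_rows 7
    [:: [:: 1; 1;  1;  1;  0;  0;  0];
        [:: 1; -1; 0;  0;  1;  1;  0];
        [:: 1; 0;  -1; 0;  -1; 0;  1];
        [:: 1; 0;  0;  -1; 0;  -1; -1];
        [:: 0; 1;  -1; 0;  0;  1;  -1];
        [:: 0; 1;  0;  -1; 1;  0;  1];
        [:: 0; 0;  1;  -1; -1; 1;  0]].

Definition W8 (R : realType) : 'M[R[i]]_8 :=
  mx_of_rows 8
    [:: [:: 1; 1;  1;  1;  0;  0;  0;  0];
        [:: 1; -1; 0;  0;  1;  1;  0;  0];
        [:: 1; 0;  -1; 0;  -1; 0;  1;  0];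
        [:: 1; 0;  0;  -1; 0;  -1; -1; 0];
        [:: 0; 1;  -1; 0;  1;  0;  0;  1];
        [:: 0; 1;  0;  -1; 0;  1;  0;  -1];
        [:: 0; 0;  1;  -1; 0;  0;  1;  1];
        [:: 0; 0;  0;  0;  1;  -1; 1;  -1]].

(* The 2 x 2 block of E_{2m}(x) at position (i, j), counted from 0; the cases
   are mutually exclusive as soon as m >= 2. *)
Definition E_block (R : realType) (m : nat) (x : R[i]) (i j : nat) :
    'M[R[i]]_2 :=
  if (i == 0%N) && (j == 0%N) then
    mx_of_rows 2 [:: [:: 1; 1];
                     [:: 1; 1]]
  else if j == i.+1 then
    mx_of_rows 2 [:: [:: 1;  1];
                     [:: -1; -1]]
  else if i == j.+1 then
    mx_of_rows 2 [:: [:: 1; -1];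
                     [:: 1; -1]]
  else if (i == m.-1) && (j == m.-1) then
    mx_of_rows 2 [:: [:: x;   - x];
                     [:: - x; x]]
  else 0.

Definition E_matrix (R : realType) (m : nat) (x : R[i]) : 'M[R[i]]_(2 * m) :=
  \matrix_(i, j) E_block m x (i %/ 2) (j %/ 2)
    (inord (i %% 2)) (inord (j %% 2)).

Inductive uw_block (R : realType) : Type :=
| BW5 | BW6 | BW7 | BW8
| BE (m : nat) (x : R[i]).

Definition block_size (R : realType) (b : uw_block R) : nat :=
  match b with
  | BW5 => 5 | BW6 => 6 | BW7 => 7 | BW8 => 8
  | BE m _ => 2 * m
  end.

Definition block_matrix (R : realType) (b : uw_block R) :
    'M[R[i]]_(block_size b) :=
  match b with
  | BW5 => W5 R
  | BW6 => W6 R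
  | BW7 => W7 R
  | BW8 => W8 R
  | BE m x => E_matrix m x
  end.

(* m <= n./2 is m <= n / 2 for the integer m. *)
Definition block_admissible (R : realType) (n : nat) (b : uw_block R) : bool :=
  match b with
  | BE m x => [&& 2 <= m, m <= n./2 & unimodular x]%N
  | _ => true
  end.

(* Main.v *)
Require Import Defs.
From mathcomp Require Import all_boot all_order all_algebra all_fingroup reals.
From mathcomp Require Import spectral trigo ring zify.

(** A UW(n,4) is peeled apart component by component. Two rows meet in 0, 2, 3
    or 4 places, since a single nonzero term cannot cancel.

    If two rows have equal support, some two rows and two columns span a
    2 x 2 block of rank one without zero entries. Orthogonality then makes the
    two rows opposite to each other, up to the factor of proportionality, outside
    of that block, so they share a second rank-one block; the same holds for the two
    columns. Following the blocks in both directions gives a zigzag chain, which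
    has to close up, and the closed chain is E_{2m}(x), the parameter x being the
    one phase that scaling cannot absorb.

    If no two rows have equal support, vanishing sums of two or three
    unimodular numbers force all entries of a component, suitably normalized, to
    be sixth roots of unity. The component is then grown row by row, always
    through a column that is not yet full; the finitely many ways of doing so all
    stop after at most eight rows, in a copy of W5, W6, W7 or W8. *)

Set Implicit Arguments.
Unset Strict Implicit.
Unset Printing Implicit Defensive.

Import Order.TTheory GRing.Theory Num.Theory.
Local Open Scope ring_scope.

(** * Vanishing sums of unimodular numbers *)

(** Which case applies is decided for all that remains of the matrix: while two rows anywhere have
    equal support, some chain is split off, and the search is entered only when no such pair is
    left. This is why an overlap of 4 never occurs in it. Sixth roots of unity arise because the
    nonzero terms of an inner product are then either two opposite numbers or three numbers with a
    common cube; so two entries of a new row that meet the same known row have equal sixth powers,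
    and a chain of such links to an entry scaled to 1 makes all of them sixth roots of unity. These
    are the units of the Eisenstein integers, in which the search computes exactly. Components have
    no bounded size, so they are encoded by families over the natural numbers together with a
    bound. *)

Section UnimodularSums.

Variable C : numClosedFieldType.
Implicit Types a b c d k s t : C.

Lemma unimod_mulJ a : `|a| = 1 -> a * a^* = 1.
Proof. by move=> a1; rewrite -normCK a1 expr1n. Qed.

Lemma unimod_neq0 a : `|a| = 1 -> a != 0.
Proof. by move=> a1; rewrite -normr_gt0 a1 ltr01. Qed.

Lemma parallelogram a b :
  `|a + b| ^+ 2 + `|a - b| ^+ 2 = `|a| ^+ 2 *+ 2 + `|b| ^+ 2 *+ 2.
Proof. by rewrite !normCK rmorphD rmorphB; ring. Qed.

(** The equality case of the triangle inequality: by the parallelogram law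
    [|s - t|^2 = 2|s|^2 + 2|t|^2 - 4], which is at most 0. *)
Lemma extremal_sum s t k : `|s| <= 1 -> `|t| <= 1 -> `|k| = 1 ->
  s + t = - (k *+ 2) -> s = - k /\ t = - k.
Proof.
move=> s1 t1 k1 st.
have d0 : s = t.
  apply/eqP; rewrite -subr_eq0 -normr_eq0 -sqrf_eq0 eq_le exprn_ge0 // andbT.
  have -> : `|s - t| ^+ 2 =
      - ((1 - `|s| ^+ 2) *+ 2 + (1 - `|t| ^+ 2) *+ 2).
    have := parallelogram s t; rewrite st normrN normrMn k1.
    set D := `|s - t| ^+ 2; move=> H; transitivity ((1 *+ 2) ^+ 2 + D - 4); first by ring.
    by rewrite H; ring.
  by rewrite oppr_le0 addr_ge0 // mulrn_wge0 // subr_ge0 exprn_ile1.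
have t2 : t *+ 2 = (- k) *+ 2 by rewrite mulNrn -st d0.
have tk : t = - k by have := eqrMn2r 2 t (- k); rewrite t2 eqxx => /esym/eqP.
by rewrite d0.
Qed.

(** Conjugation inverts unimodular numbers, so conjugating the sum shows that the third elementary
    symmetric function [e3] vanishes along with [e1]. Then
    [(a + b)(a + c)(a + d) = a^2 e1 + e3 = 0]. *)
Lemma unimod_sum4 a b c d : `|a| = 1 -> `|b| = 1 -> `|c| = 1 -> `|d| = 1 ->
  a + b + c + d = 0 -> [\/ a = - b, a = - c | a = - d].
Proof.
move=> /unimod_mulJ a1 /unimod_mulJ b1 /unimod_mulJ c1 /unimod_mulJ d1 s0.
have s0' : a^* + b^* + c^* + d^* = 0 by rewrite -!rmorphD s0 rmorph0.
have : (a + b) * (a + c) * (a + d) = 0.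
  transitivity (a ^+ 2 * (a + b + c + d) + (b * c * d * (a * a^*)
     + a * c * d * (b * b^*) + a * b * d * (c * c^*) + a * b * c * (d * d^*))).
    by rewrite a1 b1 c1 d1; ring.
  transitivity (a ^+ 2 * (a + b + c + d) + a * b * c * d * (a^* + b^* + c^* + d^*)).
    by ring.
  by rewrite s0 s0' !mulr0 addr0.
move/eqP; rewrite !mulf_eq0 !addr_eq0 -orbA => /or3P[] /eqP;
  by [constructor 1|constructor 2|constructor 3].
Qed.

(** Conjugating gives [e2 = 0] besides [e1 = 0], so the three numbers are roots of [X^3 - abc]. *)
Lemma unimod_sum3 a b c : `|a| = 1 -> `|b| = 1 -> `|c| = 1 ->
  a + b + c = 0 -> a ^+ 3 = b ^+ 3.
Proof.
move=> /unimod_mulJ a1 /unimod_mulJ b1 /unimod_mulJ c1 s0.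
have s0' : a^* + b^* + c^* = 0 by rewrite -!rmorphD s0 rmorph0.
have e2 : b * c + a * c + a * b = 0.
  transitivity (b * c * (a * a^*) + a * c * (b * b^*) + a * b * (c * c^*)).
    by rewrite a1 b1 c1; ring.
  by transitivity (a * b * c * (a^* + b^* + c^*)); [ring | rewrite s0' mulr0].
apply/eqP; rewrite -subr_eq0; apply/eqP.
transitivity ((a - b) * ((a + b) * (a + b + c) - (b * c + a * c + a * b))).
  by ring.
by rewrite s0 e2 !mulr0 subr0 mulr0.
Qed.

(* This is what confines the entries of the exhaustive search to sixth roots of
   unity. *)
Lemma unimod_sum_expr6 (s : seq C) : {in s, forall a, `|a| = 1} ->
  (size s <= 3)%N -> \sum_(a <- s) a = 0 ->
  {in s &, forall a b, a ^+ 6 = b ^+ 6}.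
Proof.
case: s => [|a [|b [|c [|//]]]] s1 _; rewrite !(big_cons, big_nil) ?addr0.
- by move=> _ a; rewrite in_nil.
- by move=> a0; have /unimod_neq0 := s1 a (mem_head _ _); rewrite a0 eqxx.
- move/eqP; rewrite addr_eq0 => /eqP ab x y; rewrite !inE => /orP[]/eqP-> /orP[]/eqP-> //;
  by rewrite ab; ring.
rewrite addrA => abc.
have [a1 b1 c1] : [/\ `|a| = 1, `|b| = 1 & `|c| = 1].
  by split; apply: s1; rewrite !inE eqxx ?orbT.
have ab := unimod_sum3 a1 b1 c1 abc.
have bc : b ^+ 3 = c ^+ 3 by apply: (unimod_sum3 b1 c1 a1); rewrite -abc; ring.
have e6 z : z ^+ 6 = (z ^+ 3) ^+ 2 by rewrite -exprM.
by move=> x y; rewrite !inE => /or3P[]/eqP-> /or3P[]/eqP->; rewrite !e6 ?ab ?bc.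
Qed.

End UnimodularSums.

(** * Duplicate-free lists inside a four-element set *)

Section CardFour.

Variables (T : finType) (A : {pred T}).
Hypothesis cardA : #|A| = 4%N.

Lemma card4_size_le s : uniq s -> {subset s <= A} -> (size s <= 4)%N.
Proof.
by move=> us sA; rewrite -cardA cardE uniq_leq_size // => x /sA; rewrite mem_enum.
Qed.

Lemma card4_subset s : uniq s -> {subset s <= A} -> size s = 4%N ->
  {subset A <= s}.
Proof.
move=> us sA s4 x xA.
have [||_ ->] := uniq_min_size (s1 := s) (s2 := enum A) us; last by rewrite mem_enum.
- by move=> y /sA; rewrite mem_enum.
- by rewrite -cardE cardA s4.
Qed.

Lemma card4_extend s : (size s < 4)%N -> exists2 x, x \in A & x \notin s.
Proof.
move=> s4; apply/exists_inP; apply: contraLR s4; rewrite negb_exists_in.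
move/forall_inP => sA; rewrite -leqNgt -cardA cardE uniq_leq_size ?enum_uniq //.
by move=> x; rewrite mem_enum => /sA; rewrite negbK.
Qed.

End CardFour.

(** * Rows with equal support *)

(* Zero rows and columns are allowed, so that a component can be peeled off by
   setting its rows to zero without changing the index types. *)
Record weighing4 (C : numClosedFieldType) (I J : finType) (W : I -> J -> C)
    : Prop := Weighing4 {
  wt_entry : forall i j, W i j != 0 -> `|W i j| = 1;
  wt_row : forall i j, W i j != 0 -> #|[pred j' | W i j' != 0]| = 4%N;
  wt_col : forall i j, W i j != 0 -> #|[pred i' | W i' j != 0]| = 4%N;
  wt_row_orth : forall i i', i != i' -> \sum_j W i j * (W i' j)^* = 0;
  wt_col_orth : forall j j', j != j' -> \sum_i W i j * (W i j')^* = 0 }.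

Lemma weighing4_tr (C : numClosedFieldType) (I J : finType) (W : I -> J -> C) :
  weighing4 W -> weighing4 (fun j i => W i j).
Proof. by case=> e r c ro co; split=> // i j; [apply: e|apply: c|apply: r]. Qed.

(** The equations give [|a + b| = |c + d|] and [|a - b| = |c - d|], hence
    [1 + |b|^2 = |c|^2 + |d|^2], which counts nonzero terms. If [b = 0], exactly one of [c], [d] is
    nonzero and the second equation forces [x = y] or [x = - y]. Otherwise all four are unimodular
    and fall into opposite pairs. *)
Lemma orth_pair_dichotomy (C : numClosedFieldType) (a b c d x y : C) :
  `|a| = 1 -> (forall z, z \in [:: b; c; d] -> z != 0 -> `|z| = 1) ->
  `|x| = 1 -> `|y| = 1 -> x != y -> x != - y ->
  a + b + c + d = 0 -> (a - b) * x + (c - d) * y = 0 ->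
  b != 0 /\ (a = b \/ a = - b).
Proof.
move=> a1 bcd1 x1 y1 xy xNy s1 s2.
have a0 := unimod_neq0 a1.
have plus : `|a + b| = `|c + d|.
  by rewrite -(normrN (c + d)); congr `|_|; apply/eqP; rewrite -addr_eq0 addrA s1.
have minus : `|a - b| = `|c - d|.
  rewrite -[LHS]mulr1 -[RHS]mulr1 -{1}x1 -y1 -!normrM -[RHS]normrN.
  by congr `|_|; apply/eqP; rewrite -addr_eq0 s2.
have := parallelogram a b; rewrite plus minus parallelogram a1 expr1n -!mulrnDl => /eqP.
rewrite eqrMn2r /= => /eqP pl.
have n2 (z : C) : `|z| = 1 -> `|z| ^+ 2 = 1 :> C by move=> ->; rewrite expr1n.
have [c1 d1] : (c != 0 -> `|c| = 1) /\ (d != 0 -> `|d| = 1).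
  by split; apply: bcd1; rewrite !inE eqxx !orbT.
have two : 1 + 1 = 2 :> C by [].
have xmy : x - y != 0 by rewrite subr_eq0.
have xpy : x + y != 0 by rewrite addr_eq0.
have [b0|b0] := eqVneq b 0.
  move: s1 s2 pl; rewrite b0 addr0 subr0 normr0 expr0n addr0 => s1 s2.
  have [c0|c0] := eqVneq c 0.
    have da : d = - a by apply/eqP; rewrite -addr_eq0 addrC -s1 c0 addr0.
    have : a * (x + y) = 0 by rewrite -s2 c0 da; ring.
    by move/eqP; rewrite mulf_eq0 (negPf a0) (negPf xpy).
  have [d0|d0] := eqVneq d 0.
    have ca : c = - a by apply/eqP; rewrite -addr_eq0 addrC -s1 d0 addr0.
    have : a * (x - y) = 0 by rewrite -s2 d0 ca; ring.
    by move/eqP; rewrite mulf_eq0 (negPf a0) (negPf xmy).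
  rewrite (n2 _ (c1 c0)) (n2 _ (d1 d0)).
  by move/eqP; rewrite two -[X in _ == X]mulr1n eqr_nat.
split=> //; move: pl; rewrite (n2 b); last by apply: bcd1; rewrite ?inE ?eqxx.
rewrite two; have [->|c0] := eqVneq c 0.
  rewrite normr0 expr0n add0r; have [->|d0] := eqVneq d 0.
    by rewrite normr0 expr0n => /eqP; rewrite eqr_nat.
  by rewrite (n2 _ (d1 d0)) => /eqP; rewrite -[X in X == _]mulr1n eqr_nat.
have [->|d0 _] := eqVneq d 0.
  by rewrite normr0 expr0n addr0 (n2 _ (c1 c0)) => /eqP; rewrite -[X in X == _]mulr1n eqr_nat.
have b1 : `|b| = 1 by apply: bcd1; rewrite ?inE ?eqxx.
have [|ac|ad] := unimod_sum4 a1 b1 (c1 c0) (d1 d0) s1; first by right.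
  have bd : b = - d by apply/eqP; rewrite -addr_eq0 -s1 ac; apply/eqP; ring.
  left; have : (a - b) * (x - y) = 0 by rewrite -s2 ac bd; ring.
  by move/eqP; rewrite mulf_eq0 (negPf xmy) orbF subr_eq0 => /eqP.
have bc : b = - c by apply/eqP; rewrite -addr_eq0 -s1 ad; apply/eqP; ring.
left; have : (a - b) * (x + y) = 0 by rewrite -s2 ad bc; ring.
by move/eqP; rewrite mulf_eq0 (negPf xpy) orbF subr_eq0 => /eqP.
Qed.

Definition rank1 (C : numClosedFieldType) (I J : finType) (W : I -> J -> C)
    p q d d' :=
  [/\ p != q, d != d', W p d != 0, W p d' != 0 &
   exists k, [/\ `|k| = 1, W q d = k * W p d & W q d' = k * W p d']].

Section Weighing.

Variables (C : numClosedFieldType) (I J : finType) (W : I -> J -> C).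
Hypothesis wW : weighing4 W.

Lemma norm_entry_le1 i j : `|W i j| <= 1.
Proof. by have [->|/(wt_entry wW) ->//] := eqVneq (W i j) 0; rewrite normr0 ler01. Qed.

Lemma row_support i s : uniq s -> size s = 4%N ->
  {in s, forall j, W i j != 0} -> forall j, W i j != 0 -> j \in s.
Proof.
move=> us s4 sW j Wij; apply: (card4_subset (wt_row wW Wij)) => //.
Qed.

Lemma row_extend i j s : W i j != 0 -> (size s < 4)%N ->
  exists2 j', W i j' != 0 & j' \notin s.
Proof.
by move=> Wij s4; have [j'] := card4_extend (wt_row wW Wij) s4; exists j'.
Qed.

Lemma row_orth_seq i i' (s : seq J) : uniq s -> i != i' ->
  (forall j, W i j != 0 -> j \in s) ->
  \sum_(j <- s) W i j * (W i' j)^* = 0.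
Proof.
move=> us ii' Ws; rewrite big_uniq //= -[RHS](wt_row_orth wW ii').
rewrite [RHS](bigID (mem s)) /= [X in _ = _ + X]big1 ?addr0 // => j.
by have [->|/Ws ->//] := eqVneq (W i j) 0; rewrite mul0r.
Qed.

Lemma row_orth_seqr i i' (s : seq J) : uniq s -> i != i' ->
  (forall j, W i' j != 0 -> j \in s) ->
  \sum_(j <- s) W i j * (W i' j)^* = 0.
Proof.
move=> us ii' Ws; apply: (can_inj (@conjCK C)).
rewrite rmorph_sum rmorph0 /= -[RHS](@row_orth_seq i' i s) // 1?eq_sym //.
by apply: eq_bigr => j _; rewrite rmorphM /= conjCK mulrC.
Qed.

(* Two proportional 2-columns of a pair of rows p, q already contribute twice a
   unimodular number to their inner product, and two further terms must cancel
   it. *)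
Lemma rank1_rows p q d d' k : p != q -> d != d' -> W p d != 0 -> W p d' != 0 ->
  `|k| = 1 -> W q d = k * W p d -> W q d' = k * W p d' ->
  (forall j, j != d -> j != d' -> W q j = - k * W p j) /\
  exists e e', [/\ uniq [:: e'; e; d; d'], W p e != 0 & W p e' != 0].
Proof.
move=> pq dd' pd pd' k1 qd qd'.
have [e pe de] := row_extend (s := [:: d; d']) pd isT.
have [e' pe' de'] := row_extend (s := [:: e; d; d']) pd isT.
have u4 : uniq [:: e'; e; d; d'] by rewrite cons_uniq de' cons_uniq de /= inE dd'.
have psupp : forall j, W p j != 0 -> j \in [:: e'; e; d; d'].
  apply: row_support => // j; rewrite !inE => /or4P[] /eqP-> //.
split; last by exists e, e'.
have pJ j : W p j != 0 -> W p j * (W p j)^* = 1 by move=> /(wt_entry wW)/unimod_mulJ.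
have term j : W q j = k * W p j -> W p j != 0 -> W p j * (W q j)^* = k^*.
  by move=> -> /pJ pj1; rewrite rmorphM mulrCA pj1 mulr1.
have := row_orth_seq u4 pq psupp.
rewrite !big_cons big_nil (term d) // (term d') // addr0.
have le1 j : `|W p j * (W q j)^*| <= 1.
  by rewrite normrM norm_conjC mulr_ile1 ?normr_ge0 ?norm_entry_le1.
rewrite addrA -mulr2n => /eqP; rewrite addr_eq0 => /eqP sum0.
have kJ1 : `|k^*| = 1 by rewrite norm_conjC.
have [qe' qe] := extremal_sum (le1 e') (le1 e) kJ1 sum0.
have solve j : W p j != 0 -> W p j * (W q j)^* = - k^* -> W q j = - k * W p j.
  move=> pj H; have {}H : (W p j)^* * W q j = - k.
    by rewrite -[W q j]conjCK -rmorphM H rmorphN /= conjCK.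
  by rewrite -H mulrAC [_^* * _]mulrC pJ // mul1r.
move=> j jd jd'; have [pj0|pj] := eqVneq (W p j) 0; last first.
  by move: (psupp j pj); rewrite !inE (negPf jd) (negPf jd') !orbF => /orP[]/eqP->;
    apply: solve.
(* Outside the support of [p] the row [q] vanishes, because its four nonzero entries already lie in
   that support. *)
rewrite pj0 mulr0; apply/eqP; apply: contraTT isT => qj.
have qn0 : forall j', j' \in [:: e'; e; d; d'] -> W q j' != 0.
  have kn0 := unimod_neq0 k1; have Nkn0 : - k != 0 by rewrite oppr_eq0.
  move=> j'; rewrite !inE => /or4P[] /eqP->.
  - by rewrite (solve e') ?mulf_neq0.
  - by rewrite (solve e) ?mulf_neq0.
  - by rewrite qd mulf_neq0.
  - by rewrite qd' mulf_neq0.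
have := row_support u4 (erefl _) qn0 qj; rewrite !inE (negPf jd) (negPf jd') !orbF.
by case/orP=> /eqP jE; move/eqP: pj0; rewrite jE ?(negPf pe) ?(negPf pe').
Qed.

(** Let [r] be the quotient of row [q] by row [p], so that [r a = - r b] and [r c = - r d]. If [r a]
    is [r c] or [- r c], the rows [p] and [q] are proportional on two columns. If not, a third row
    [z] through column [a] is orthogonal to both, and [orth_pair_dichotomy] makes it proportional on
    [a], [b] either to [p] or, since [r] changes sign there, to [q]. *)
Lemma rank1_same_support_aux p q (a b c d : J) : p != q -> uniq [:: a; b; c; d] ->
  (forall j, j \in [:: a; b; c; d] = (W p j != 0)) ->
  (forall j, j \in [:: a; b; c; d] = (W q j != 0)) ->
  W q a * (W p a)^* = - (W q b * (W p b)^*) ->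
  exists p' q' e e', rank1 W p' q' e e'.
Proof.
move=> pq us sp sq; set r := fun j => W q j * (W p j)^*; rewrite -/(r a) -/(r b) => rab.
have unit1 i j : W i j != 0 -> W i j * (W i j)^* = 1 by move=> /(wt_entry wW)/unimod_mulJ.
have [sa sb sc sd] : [/\ a \in [:: a; b; c; d], b \in [:: a; b; c; d],
  c \in [:: a; b; c; d] & d \in [:: a; b; c; d]] by rewrite !inE !eqxx !orbT.
have [[pa pb pc pd] [qa qb qc qd]] : [/\ W p a != 0, W p b != 0, W p c != 0 & W p d != 0]
  /\ [/\ W q a != 0, W q b != 0, W q c != 0 & W q d != 0] by rewrite -!sp -!sq.
have mulp z j : W p j != 0 -> W z j = (W z j * (W p j)^*) * W p j.
  by move=> pj; rewrite -mulrA [_^* * _]mulrC unit1 ?mulr1.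
have r1 j : W p j != 0 -> W q j != 0 -> `|r j| = 1.
  by move=> pj qj; rewrite normrM norm_conjC !(wt_entry wW) ?mulr1.
have rsum : r a + r b + r c + r d = 0.
  have := @row_orth_seqr q p _ us; rewrite eq_sym => /(_ pq) <-; last by move=> j; rewrite sp.
  by rewrite !big_cons big_nil addr0 !addrA.
have rcd : r c = - r d by apply/eqP; rewrite -addr_eq0 -rsum rab addNr add0r.
have neq : [/\ a != c, a != d & a != b].
  by move: us; rewrite /= !inE !negb_or => /andP[/and3P[-> -> ->]].
have [nac nad nab] := neq.
have [rac|rac] := eqVneq (r a) (r c).
  exists p, q, a, c; split=> //; exists (r a); split; rewrite ?r1 -?mulp //.
  by rewrite rac -mulp.
have [rad|rad] := eqVneq (r a) (- r c).
  exists p, q, a, d; split=> //; exists (r a); split; rewrite ?r1 -?mulp //.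
  by rewrite rad rcd opprK -mulp.
have [z zna zpq] : exists2 z, W z a != 0 & z \notin [:: p; q].
  exact: (@card4_extend _ _ (wt_col wW pa) [:: p; q]).
have [zp zq] : z != p /\ z != q by move: zpq; rewrite !inE negb_or => /andP.
set t := fun j => W z j * (W p j)^*.
have t1 j : W p j != 0 -> t j != 0 -> `|t j| = 1.
  by rewrite mulf_eq0 negb_or => pj /andP[zj _]; rewrite normrM norm_conjC !(wt_entry wW) ?mulr1.
have tsum : t a + t b + t c + t d = 0.
  have := @row_orth_seqr z p _ us zp => <-; last by move=> j; rewrite sp.
  by rewrite !big_cons big_nil addr0 !addrA.
have tr j : W p j != 0 -> W z j * (W q j)^* = t j * (r j)^*.
  move=> pj; rewrite [W q j](mulp q) // -/(r j) {1}[W z j](mulp z) // -/(t j).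
  by rewrite rmorphM mulrACA [W p j * _]unit1 ?mulr1.
have trsum : (t a - t b) * (r a)^* + (t c - t d) * (r c)^* = 0.
  have := @row_orth_seqr z q _ us zq => H; rewrite -[RHS]H; last by move=> j; rewrite sq.
  by rewrite !big_cons big_nil addr0 !tr // rab rcd !rmorphN /=; ring.
have conj_neq (x y : C) : x != y -> x^* != y^*.
  by move=> /eqP xy; apply/eqP => H; apply: xy; rewrite -[x]conjCK H conjCK.
have [tb0 ab] : t b != 0 /\ (t a = t b \/ t a = - t b).
  apply: orth_pair_dichotomy tsum trsum.
  - by rewrite t1 // mulf_neq0 ?conjC_eq0.
  - by move=> x; rewrite !inE => /or3P[] /eqP->; apply: t1.
  - by rewrite norm_conjC r1.
  - by rewrite norm_conjC r1.
  - exact: conj_neq.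
  - by rewrite -rmorphN conj_neq.
have tan0 : t a != 0 by rewrite mulf_neq0 ?conjC_eq0.
case: ab => ab.
  exists p, z, a, b; split=> //; first by rewrite eq_sym.
  by exists (t a); rewrite t1 // -mulp // {1}ab -mulp.
exists q, z, a, b; split=> //; first by rewrite eq_sym.
exists (t a * (r a)^*); split.
- by rewrite normrM norm_conjC t1 ?r1 ?mulr1.
- by rewrite -tr // -mulrA [_^* * _]mulrC unit1 ?mulr1.
have -> : t a * (r a)^* = t b * (r b)^* by rewrite ab rab rmorphN mulrNN.
by rewrite -tr // -mulrA [_^* * _]mulrC unit1 ?mulr1.
Qed.

(** Inclusion of supports is equality, as both have four elements. The four-term inner product pairs
    column [a] with an opposite one, which relabelling turns into the second column. *)
Lemma rank1_same_support p q j0 : p != q -> W p j0 != 0 ->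
  (forall j, W p j != 0 -> W q j != 0) -> exists p' q' e e', rank1 W p' q' e e'.
Proof.
move=> pq pj0 sub.
have [s us ss] : exists2 s, uniq s & size s = 4%N /\ s =i [pred j | W p j != 0].
  exists (enum [pred j | W p j != 0]); first exact: enum_uniq.
  by rewrite -cardE (wt_row wW pj0); split=> // j; rewrite mem_enum.
case: s us ss => [|a [|b [|c [|d [|? ?]]]]] us [] // _ sp.
have {}sp j : (j \in [:: a; b; c; d]) = (W p j != 0) by rewrite sp inE.
have sq j : (j \in [:: a; b; c; d]) = (W q j != 0).
  apply/idP/idP => [|qj]; first by rewrite sp; apply: sub.
  by apply: row_support qj => // j'; rewrite sp; apply: sub.
have r1 j : j \in [:: a; b; c; d] -> `|W q j * (W p j)^*| = 1.
  by move=> js; rewrite normrM norm_conjC !(wt_entry wW) ?mulr1 -?sp -?sq.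
have sum0 : \sum_(j <- [:: a; b; c; d]) W q j * (W p j)^* = 0.
  by apply: row_orth_seqr => //; [rewrite eq_sym | move=> j; rewrite sp].
have aux (x y z : J) : perm_eq [:: a; x; y; z] [:: a; b; c; d] ->
    W q a * (W p a)^* = - (W q x * (W p x)^*) -> exists p' q' e e', rank1 W p' q' e e'.
  move=> pe; apply: (@rank1_same_support_aux p q a x y z) => // [|j|j].
  - by rewrite (perm_uniq pe).
  - by rewrite (perm_mem pe).
  - by rewrite (perm_mem pe).
rewrite !big_cons big_nil addr0 !addrA in sum0.
have r4 : [/\ `|W q a * (W p a)^*| = 1, `|W q b * (W p b)^*| = 1,
  `|W q c * (W p c)^*| = 1 & `|W q d * (W p d)^*| = 1].
  by split; apply: r1; rewrite !inE eqxx ?orbT.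
case: r4 => ra rb rc rd; case: (unimod_sum4 ra rb rc rd sum0) => rel.
- exact: (aux b c d).
- by apply: (aux c b d) => //; rewrite perm_cons (perm_catCA [:: c] [:: b] [:: d]).
- by apply: (aux d b c) => //; rewrite perm_cons (perm_catC [:: d] [:: b; c]).
Qed.

End Weighing.

(** * Chains of rank-one blocks *)

(** A direct summand of [W] up to permutation and phases: the chosen rows and columns carry [M], and
    the two closure fields say that nothing else in them is nonzero. *)
Record summand (C : numClosedFieldType) (I J : finType) (W : I -> J -> C)
    (k : nat) (M : nat -> nat -> C)
    (f : nat -> I) (g : nat -> J) (u v : nat -> C) : Prop := Summand {
  sm_inj_row : forall x y, (x < k)%N -> (y < k)%N -> f x = f y -> x = y;
  sm_inj_col : forall x y, (x < k)%N -> (y < k)%N -> g x = g y -> x = y;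
  sm_unit_row : forall x, (x < k)%N -> `|u x| = 1;
  sm_unit_col : forall x, (x < k)%N -> `|v x| = 1;
  sm_entry : forall x y, (x < k)%N -> (y < k)%N ->
    W (f x) (g y) = u x * v y * M x y;
  sm_row_closed : forall x j, (x < k)%N -> W (f x) j != 0 ->
    exists2 y, (y < k)%N & j = g y;
  sm_col_closed : forall i y, (y < k)%N -> W i (g y) != 0 ->
    exists2 x, (x < k)%N & i = f x }.

(* Entry (a, b) of the block (i, j) of E_{2m}(x), for every m and x, except for
   the last diagonal block. *)
Definition chain_entry (C : numClosedFieldType) (i j : nat) (a b : bool) : C :=
  if (i == 0%N) && (j == 0%N) then 1
  else if j == i.+1 then (-1) ^+ a
  else if i == j.+1 then (-1) ^+ b
  else 0.

Definition E_entry (C : numClosedFieldType) (m : nat) (x : C) (s t : nat) : C :=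
  if (s./2 == m.-1) && (t./2 == m.-1) then x * (-1) ^+ odd s * (-1) ^+ odd t
  else chain_entry C s./2 t./2 (odd s) (odd t).

(* Rows and columns come in pairs, indexed by a block number and a boolean; the
   pairs r (m-1) and c (m-1) are the two loose ends of the chain. *)
Record chain (C : numClosedFieldType) (I J : finType) (W : I -> J -> C) (m : nat)
    (r : nat -> bool -> I) (c : nat -> bool -> J) (u v : nat -> bool -> C)
    : Prop := Chain {
  ch_inj_row : forall i i' a a', (i < m)%N -> (i' < m)%N -> r i a = r i' a' ->
    i = i' /\ a = a';
  ch_inj_col : forall i i' a a', (i < m)%N -> (i' < m)%N -> c i a = c i' a' ->
    i = i' /\ a = a';
  ch_unit_row : forall i a, (i < m)%N -> `|u i a| = 1;
  ch_unit_col : forall i a, (i < m)%N -> `|v i a| = 1;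
  ch_entry : forall i j a b, (i < m)%N -> (j < m)%N ->
    (i.+1 < m)%N || (j.+1 < m)%N ->
    W (r i a) (c j b) = u i a * v j b * chain_entry C i j a b;
  ch_row_closed : forall i a y, (i.+1 < m)%N -> W (r i a) y != 0 ->
    exists j b, (j < m)%N /\ y = c j b;
  ch_col_closed : forall j b x, (j.+1 < m)%N -> W x (c j b) != 0 ->
    exists i a, (i < m)%N /\ x = r i a }.

Lemma chain_entry0 (C : numClosedFieldType) i j a b :
  (0 < i + j)%N -> j != i.+1 -> i != j.+1 -> chain_entry C i j a b = 0.
Proof. by rewrite /chain_entry => ij /negPf-> /negPf->; case: ifP => //; lia. Qed.

Lemma chain_entry_tr (C : numClosedFieldType) i j a b :
  chain_entry C i j a b = chain_entry C j i b a.
Proof.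
rewrite /chain_entry andbC; case: ifP => // _.
by case: (j =P _); case: (i =P _) => //; lia.
Qed.

(** This symmetry yields each fact about the last two columns from the one about the last two
    rows. *)
Lemma chain_tr (C : numClosedFieldType) (I J : finType) (W : I -> J -> C) m r c u v :
  chain W m r c u v -> chain (fun j i => W i j) m c r v u.
Proof.
case=> ir ic ur uc en rc cc; split=> // i j a b im jm lt.
by rewrite en // 1?orbC // chain_entry_tr [u _ _ * _]mulrC.
Qed.

Section Chain.

Variables (C : numClosedFieldType) (I J : finType) (W : I -> J -> C).
Hypothesis wW : weighing4 W.

(** The last two rows are proportional on the column pair [c l], so [rank1_rows] makes them opposite
    elsewhere and supplies two more columns [e]. Whether these are the columns [c l.+1] or new ones
    is left open here. *)
Lemma chain_loose_end l r c u v : chain W l.+2 r c u v ->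
  (forall y, (forall b, y != c l b) ->
     u l.+1 false * W (r l.+1 true) y = - (u l.+1 true * W (r l.+1 false) y)) /\
  exists (e : bool -> J) (w : bool -> C), [/\ e false != e true,
    forall b b', e b != c l b', forall b, `|w b| = 1,
    forall a b, W (r l.+1 a) (e b) = u l.+1 a * w b * (-1) ^+ a &
    forall a y, W (r l.+1 a) y != 0 -> exists b, y = c l b \/ y = e b].
Proof.
move=> ch; set L := l.+1; have ul a : `|u L a| = 1 by apply: (ch_unit_row ch).
have u0 a : u L a != 0 by apply: unimod_neq0.
have vl a : `|v l a| = 1 by apply: (ch_unit_col ch); lia.
have v0 a : v l a != 0 by apply: unimod_neq0.
have ent a b : W (r L a) (c l b) = u L a * v l b * (-1) ^+ b.
  rewrite (ch_entry ch) ?leqnn ?orbT // /chain_entry /L eqxx /=.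
  by case: eqP => //; lia.
have pq : r L false != r L true by apply/eqP => /(ch_inj_row ch)[] //; rewrite /L; lia.
have dd : c l false != c l true by apply/eqP => /(ch_inj_col ch)[] //; lia.
have k1 : `|u L true / u L false| = 1 by rewrite normrM normfV !ul divr1.
have ent0 a b : W (r L a) (c l b) != 0 by rewrite ent !mulf_neq0 // signr_eq0.
have [||prop [e [e' [us pe pe']]]] := rank1_rows wW pq dd (ent0 _ _) (ent0 _ _) k1.
- by rewrite !ent mulrA mulrA divfK.
- by rewrite !ent mulrA mulrA divfK.
have {}prop y : (forall b, y != c l b) ->
    u L false * W (r L true) y = - (u L true * W (r L false) y).
  by move=> yc; rewrite prop // mulNr mulrN mulrA mulrCA mulfV ?mulr1.
split=> //.
have edc x : x \in [:: e'; e] -> forall b, x != c l b.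
  move: us; rewrite /= !inE !negb_or => /and4P[/and3P[_ ? ?] /andP[? ?] _ _].
  by case/orP=> /eqP-> [].
exists (fun b => if b then e' else e), (fun b => W (r L false) (if b then e' else e) / u L false).
have ent' a b : W (r L a) (if b then e' else e) =
    u L a * (W (r L false) (if b then e' else e) / u L false) * (-1) ^+ a.
  case: a; last by rewrite mulr1 mulrC divfK.
  apply: (mulfI (u0 false)); rewrite prop; last by apply: edc; case: b; rewrite !inE eqxx ?orbT.
  by rewrite expr1 mulrN1 mulrN [in RHS]mulrC mulrA divfK // mulrC.
split=> //.
- by move: us; rewrite /= !inE !negb_or eq_sym => /andP[/and3P[]].
- by move=> b b'; apply: edc; case: b; rewrite !inE eqxx ?orbT.
- by move=> b; rewrite normrM normfV ul divr1 (wt_entry wW) //; case: b.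
move=> a y ay.
have : y \in [:: e'; e; c l false; c l true].
  apply: (row_support wW us _ _ ay) => // x; rewrite !inE => /or4P[] /eqP-> //.
  - by rewrite (ent' a true) !mulf_neq0 ?invr_eq0 ?signr_eq0.
  - by rewrite (ent' a false) !mulf_neq0 ?invr_eq0 ?signr_eq0.
rewrite !inE => /or4P[] /eqP->; [exists true|exists false|exists false|exists true]; auto.
Qed.

Lemma chain_full_row l r c u v a : chain W l.+2 r c u v ->
  (forall b, W (r l.+1 a) (c l.+1 b) != 0) ->
  forall y, W (r l.+1 a) y != 0 -> exists j b, (j < l.+2)%N /\ y = c j b.
Proof.
move=> ch Wn0 y ay.
have us : uniq [:: c l false; c l true; c l.+1 false; c l.+1 true].
  have ne i i' b b' : (i < l.+2)%N -> (i' < l.+2)%N -> (i != i') || (b != b') ->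
      c i b != c i' b'.
    move=> il il' H; apply/eqP => /(ch_inj_col ch)-/(_ il il')[e1 e2].
    by move: H; rewrite e1 e2 !eqxx.
  by rewrite /= !inE !negb_or !ne //=; lia.
have : y \in [:: c l false; c l true; c l.+1 false; c l.+1 true].
  apply: (row_support wW us _ _ ay) => // x.
  have Wl b : W (r l.+1 a) (c l b) != 0.
    rewrite (ch_entry ch) ?leqnn ?orbT // /chain_entry eqxx /=.
    have -> : (l == l.+2) = false by lia.
    by rewrite !mulf_neq0 ?signr_eq0 // unimod_neq0 ?(ch_unit_row ch) ?(ch_unit_col ch).
  by rewrite !inE => /or4P[] /eqP->.
rewrite !inE => /or4P[] /eqP->; [exists l, false|exists l, true|exists l.+1, false|
  exists l.+1, true]; split=> //; lia.
Qed.

End Chain.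

(** * Closing or prolonging a chain *)

Section ChainStep.

Variables (C : numClosedFieldType) (I J : finType) (W : I -> J -> C).
Hypothesis wW : weighing4 W.

(** The last two rows are opposite outside [c l] and the last two columns outside [r l], so one
    entry determines the whole corner block. Its phase [z] may be 0. *)
Lemma chain_corner l r c u v : chain W l.+2 r c u v ->
  exists z, forall a b,
    W (r l.+1 a) (c l.+1 b) = u l.+1 a * v l.+1 b * (z * (-1) ^+ a * (-1) ^+ b).
Proof.
move=> ch; set L := l.+1.
have [rows _] := chain_loose_end wW ch.
have [cols _] := chain_loose_end (weighing4_tr wW) (chain_tr ch).
have u0 a : u L a != 0 by apply: unimod_neq0; apply: (ch_unit_row ch).
have v0 a : v L a != 0 by apply: unimod_neq0; apply: (ch_unit_col ch).
have ncl b b' : c L b != c l b' by apply/eqP => /(ch_inj_col ch)[] //; rewrite /L; lia.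
have nrl b b' : r L b != r l b' by apply/eqP => /(ch_inj_row ch)[] //; rewrite /L; lia.
exists (W (r L false) (c L false) / (u L false * v L false)).
set z := _ / _.
have ff : W (r L false) (c L false) = u L false * v L false * z.
  by rewrite /z mulrC divfK ?mulf_neq0.
have ft : W (r L false) (c L true) = u L false * v L true * - z.
  apply: (mulfI (v0 false)); rewrite cols ?ff //; ring.
have tb b : W (r L true) (c L b) = - (u L true * W (r L false) (c L b)) / u L false.
  by apply: (mulfI (u0 false)); rewrite rows // [RHS]mulrC divfK.
by case=> [] []; rewrite ?tb ?ff ?ft ?expr0 ?expr1; field.
Qed.

(** A nonzero corner uses up the last free places in the last two rows and columns; its phase [z] is
    the parameter of the block. *)
Lemma chain_close l r c u v : chain W l.+2 r c u v ->
  W (r l.+1 false) (c l.+1 false) != 0 ->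
  exists x f g u' v', `|x| = 1 /\ summand W (2 * l.+2) (E_entry l.+2 x) f g u' v'.
Proof.
move=> ch W0; have [z corner] := chain_corner ch; exists z.
have unr a : `|u l.+1 a| = 1 by apply: (ch_unit_row ch).
have unc a : `|v l.+1 a| = 1 by apply: (ch_unit_col ch).
have z1 : `|z| = 1.
  by have := wt_entry wW W0; rewrite corner !normrM unr unc !normr1 !mulr1 !mul1r.
exists (fun t => r t./2 (odd t)), (fun t => c t./2 (odd t)),
  (fun t => u t./2 (odd t)), (fun t => v t./2 (odd t)); split=> //.
have half t : (t < 2 * l.+2)%N -> (t./2 < l.+2)%N by lia.
have halfK j (b : bool) : (j < l.+2)%N ->
    [/\ (b + j.*2 < 2 * l.+2)%N, (b + j.*2)./2 = j & odd (b + j.*2) = b].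
  by move=> lj; split; [case: b; lia | rewrite half_bit_double | rewrite oddD odd_double addbF;
      case: b].
have inj2 x y : (x./2 = y./2 /\ odd x = odd y) -> x = y.
  by case=> e1 e2; rewrite -(odd_double_half x) -(odd_double_half y) e1 e2.
have corner0 a b : W (r l.+1 a) (c l.+1 b) != 0.
  by rewrite corner !mulf_neq0 ?signr_eq0 // unimod_neq0.
split.
- by move=> x y /half x2 /half y2 /(ch_inj_row ch)-/(_ x2 y2)/inj2.
- by move=> x y /half x2 /half y2 /(ch_inj_col ch)-/(_ x2 y2)/inj2.
- by move=> x /half; apply: (ch_unit_row ch).
- by move=> x /half; apply: (ch_unit_col ch).
- move=> x y /half x2 /half y2; rewrite /E_entry /=; case: ifP => [/andP[/eqP-> /eqP->]|].
    exact: corner.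
  by move=> /negbT; rewrite negb_and => H; apply: (ch_entry ch) => //; lia.
- move=> x y /half x2 Wxy.
  have [j [b [jl ->]]] : exists j b, (j < l.+2)%N /\ y = c j b.
    have [xl|xl] := ltnP x./2 l.+1; first by apply: (ch_row_closed ch) xl Wxy.
    have xE : x./2 = l.+1 by lia.
    by move: Wxy; rewrite xE => /(chain_full_row wW ch (corner0 _)).
  by have [lt h o] := halfK j b jl; exists (b + j.*2)%N; rewrite ?h ?o.
move=> x y /half y2 Wxy.
have [j [b [jl ->]]] : exists j b, (j < l.+2)%N /\ x = r j b.
  have [yl|yl] := ltnP y./2 l.+1; first by apply: (ch_col_closed ch) yl Wxy.
  have yE : y./2 = l.+1 by lia.
  move: Wxy; rewrite yE => Wxy.
  have H := @chain_full_row _ _ _ _ (weighing4_tr wW) l c r v u (odd y) (chain_tr ch).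
  by apply: H.
by have [lt h o] := halfK j b jl; exists (b + j.*2)%N; rewrite ?h ?o.
Qed.

(** With a zero corner, the remaining nonzero entries of the last rows and columns lie in columns
    [e] and rows [s]. These are new: among the old columns, the last rows meet only the pair [c l],
    from which [e] is disjoint, and dually for [s]. *)
Lemma chain_extend l r c u v : chain W l.+2 r c u v ->
  W (r l.+1 false) (c l.+1 false) = 0 -> exists r' c' u' v', chain W l.+3 r' c' u' v'.
Proof.
move=> ch W0; have [z corner] := chain_corner ch.
have u0 i a : (i < l.+2)%N -> u i a != 0 by move=> im; apply/unimod_neq0/(ch_unit_row ch).
have v0 i a : (i < l.+2)%N -> v i a != 0 by move=> im; apply/unimod_neq0/(ch_unit_col ch).
have {}corner a b : W (r l.+1 a) (c l.+1 b) = 0.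
  move: W0; rewrite !corner !mulr1 => /eqP; rewrite !mulf_eq0 (negPf (u0 _ _ _)) //.
  by rewrite (negPf (v0 _ _ _)) //= => /eqP->; rewrite !mul0r mulr0.
have [_ [e [w [e_neq e_c w1 e_ent e_cl]]]] := chain_loose_end wW ch.
have [_ [s [t [s_neq s_r t1 s_ent s_cl]]]] :=
  chain_loose_end (weighing4_tr wW) (chain_tr ch).
have W_e a b : W (r l.+1 a) (e b) != 0.
  by rewrite e_ent !mulf_neq0 ?signr_eq0 ?u0 // unimod_neq0.
have W_s a b : W (s b) (c l.+1 a) != 0.
  by rewrite s_ent !mulf_neq0 ?signr_eq0 ?v0 // unimod_neq0.
have e_new i b a : (i < l.+2)%N -> e b <> c i a.
  move=> il eE; have := W_e false b; rewrite eE.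
  have [->|iL] := eqVneq i l.+1; first by rewrite corner eqxx.
  have [iE|ine] := eqVneq i l; first by move/eqP: eE; rewrite iE (negPf (e_c _ _)).
  rewrite (ch_entry ch) // 1?orbC; last by lia.
  by rewrite chain_entry0 ?mulr0 ?eqxx //; lia.
have s_new i b a : (i < l.+2)%N -> s b <> r i a.
  move=> il sE; have := W_s false b; rewrite sE.
  have [->|iL] := eqVneq i l.+1; first by rewrite corner eqxx.
  have [iE|ine] := eqVneq i l; first by move/eqP: sE; rewrite iE (negPf (s_r _ _)).
  rewrite (ch_entry ch) //; last by lia.
  by rewrite chain_entry0 ?mulr0 ?eqxx //; lia.
exists (fun i => if i == l.+2 then s else r i), (fun i => if i == l.+2 then e else c i),
  (fun i => if i == l.+2 then t else u i), (fun i => if i == l.+2 then w else v i).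
split.
- move=> i i' a a' im im'; case: (i =P l.+2) => [->|iE]; case: (i' =P l.+2) => [->|iE'].
  + by case: a a' => [] [] // /eqP; rewrite ?(negPf s_neq) // eq_sym (negPf s_neq).
  + by move=> /s_new[]; lia.
  + by move=> /esym/s_new[]; lia.
  + by apply: (ch_inj_row ch); lia.
- move=> i i' a a' im im'; case: (i =P l.+2) => [->|iE]; case: (i' =P l.+2) => [->|iE'].
  + by case: a a' => [] [] // /eqP; rewrite ?(negPf e_neq) // eq_sym (negPf e_neq).
  + by move=> /e_new[]; lia.
  + by move=> /esym/e_new[]; lia.
  + by apply: (ch_inj_col ch); lia.
- by move=> i a im; case: (i =P l.+2) => [//|iE]; apply: (ch_unit_row ch); lia.
- by move=> i a im; case: (i =P l.+2) => [//|iE]; apply: (ch_unit_col ch); lia.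
- move=> i j a b im jm.
  case: (i =P l.+2) => [->|iE]; case: (j =P l.+2) => [->|jE] H; first by lia.
  + have [->|jL] := eqVneq j l.+1.
      rewrite s_ent /chain_entry eqxx /=; have -> : (l.+1 == l.+3) = false by lia.
      by rewrite [t a * _]mulrC.
    rewrite chain_entry0 ?mulr0; [|lia..].
    (* A column pair of index below [l.+1] is closed, so it cannot meet a new row. *)
    apply/eqP; apply: contraT => /(ch_col_closed ch)[|i' [a' [im' /s_new[]]]] //; lia.
  + have [->|iL] := eqVneq i l.+1.
      by rewrite e_ent /chain_entry eqxx /=.
    rewrite chain_entry0 ?mulr0; [|lia..].
    apply/eqP; apply: contraT => /(ch_row_closed ch)[|i' [a' [im' /e_new[]]]] //; lia.
  + have [/andP[/eqP-> /eqP->]|nL] := boolP ((i == l.+1) && (j == l.+1)).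
      rewrite corner /chain_entry /=; have -> : (l.+1 == l.+2) = false by lia.
      by rewrite mulr0.
    by rewrite (ch_entry ch) //; move: nL; rewrite negb_and; lia.
- move=> i a y im; have -> : (i == l.+2) = false by lia.
  have [il|il] := ltnP i l.+1.
    move=> /(ch_row_closed ch)-/(_ il)[j [b [jl ->]]]; exists j, b.
    by rewrite (ltn_eqF jl); split=> //; lia.
  have -> : i = l.+1 by lia.
  move=> /e_cl[b [->|->]].
    by exists l, b; rewrite ltn_eqF //; split=> //; lia.
  by exists l.+2, b; rewrite eqxx.
- move=> i a y im; have -> : (i == l.+2) = false by lia.
  have [il|il] := ltnP i l.+1.
    move=> /(ch_col_closed ch)-/(_ il)[j [b [jl ->]]]; exists j, b.
    by rewrite (ltn_eqF jl); split=> //; lia.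
  have -> : i = l.+1 by lia.
  move=> /s_cl[b [->|->]].
    by exists l, b; rewrite ltn_eqF //; split=> //; lia.
  by exists l.+2, b; rewrite eqxx.
Qed.

Lemma chain_component m r c u v : (1 < m)%N -> chain W m r c u v ->
  exists m' x f g u' v', [/\ (1 < m')%N, `|x| = 1 &
    summand W (2 * m') (E_entry m' x) f g u' v'].
Proof.
(* Distinct block numbers give distinct rows, so a chain has at most [#|I|] blocks and prolonging it
   must stop. *)
have [n] := ubnP (#|I|.+1 - m)%N; elim: n m r c u v => // n IHn m r c u v mn m1 ch.
case: m => [|[|l]] // in mn m1 ch *.
have [W0|W0] := eqVneq (W (r l.+1 false) (c l.+1 false)) 0; last first.
  by have [x [f [g [u' [v' [x1 sm]]]]]] := chain_close ch W0; exists l.+2, x, f, g, u', v'.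
have [r' [c' [u' [v' ch']]]] := chain_extend ch W0.
apply: IHn ch' => //.
have : (l.+2 <= #|I|)%N.
  rewrite -[l.+2]card_ord -(card_image (f := fun i : 'I_l.+2 => r i false)) ?max_card //.
  move=> i i' ri; apply: val_inj.
  by have [] := ch_inj_row ch (ltn_ord i) (ltn_ord i') ri.
lia.
Qed.

(** Rows proportional on two columns make these columns proportional on the two rows, so the block
    continues in both directions. Scaling columns by row [p], and rows by column [d] divided by
    [W p d], turns the block into all ones. *)
Lemma chain_start p q d d' : rank1 W p q d d' -> exists r c u v, chain W 2 r c u v.
Proof.
case=> pq dd pd pd' [k [k1 qd qd']].
have [rows [e [e' [ue pe pe']]]] := rank1_rows wW pq dd pd pd' k1 qd qd'.
have h1 : `|W p d' / W p d| = 1 by rewrite normrM normfV !(wt_entry wW) ?divr1.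
have ph : W p d' = W p d' / W p d * W p d by rewrite divfK.
have qh : W q d' = W p d' / W p d * W q d by rewrite qd qd' mulrCA divfK.
have qd0 : W q d != 0 by rewrite qd mulf_neq0 // unimod_neq0.
have qd'0 : W q d' != 0 by rewrite qd' mulf_neq0 // unimod_neq0.
have [cols [s [s' [us sd sd']]]] := rank1_rows (weighing4_tr wW) dd pq pd qd0 h1 ph qh.
have Ne : [/\ e' != e, e' != d, e' != d', e != d & e != d'].
  by move: ue; rewrite /= !inE !negb_or => /and4P[/and3P[-> -> ->] /andP[-> ->]].
have Ns : [/\ s' != s, s' != p, s' != q, s != p & s != q].
  by move: us; rewrite /= !inE !negb_or => /and4P[/and3P[-> -> ->] /andP[-> ->]].
case: Ne Ns => e'e e'd e'd' ed ed' [s's s'p s'q sp sq].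
pose r (i : nat) (a : bool) := if i is 0 then if a then q else p else if a then s' else s.
pose c (i : nat) (a : bool) := if i is 0 then if a then d' else d else if a then e' else e.
have un i j : W i j != 0 -> `|W i j| = 1 by apply: (wt_entry wW).
exists r, c, (fun i a => if i is 0 then if a then k else 1 else W (r i a) d / W p d),
  (fun i b => W p (c i b)).
split.
- move=> [|[|//]] [|[|//]] [] [] _ _ /eqP //=;
    by rewrite ?(negPf pq) ?(negPf s's) ?(negPf s'p) ?(negPf s'q) ?(negPf sp) ?(negPf sq) //
      eq_sym ?(negPf pq) ?(negPf s's) ?(negPf s'p) ?(negPf s'q) ?(negPf sp) ?(negPf sq).
- move=> [|[|//]] [|[|//]] [] [] _ _ /eqP //=;
    by rewrite ?(negPf dd) ?(negPf e'e) ?(negPf e'd) ?(negPf e'd') ?(negPf ed) ?(negPf ed') //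
      eq_sym ?(negPf dd) ?(negPf e'e) ?(negPf e'd) ?(negPf e'd') ?(negPf ed) ?(negPf ed').
- move=> [|[|//]] [] _ //=; first by rewrite normr1.
  + by rewrite normrM normfV !un ?divr1.
  + by rewrite normrM normfV !un ?divr1.
- by move=> [|[|//]] [] _ /=; apply: un.
- move=> [|[|//]] [|[|//]] a b _ _ // _; rewrite /chain_entry /= ?mulr1.
  + by case: a; case: b; rewrite /= ?mul1r.
  + by case: a; case: b; rewrite /= ?mul1r ?expr0 ?mulr1 // rows // expr1 mulrN1 mulNr.
  + by case: a; case: b; rewrite /= ?expr0 ?mulr1 ?divfK // cols // expr1; field.
- move=> [|//] a y _ Wy.
  have : y \in [:: e'; e; d; d'].
    apply: (row_support wW ue _ _ Wy) => // x; rewrite !inE => /or4P[] /eqP->;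
      by case: a {Wy} => //=; rewrite rows // mulf_neq0 // oppr_eq0 unimod_neq0.
  by rewrite !inE => /or4P[] /eqP->;
    [exists 1%N, true|exists 1%N, false|exists 0%N, false|exists 0%N, true].
move=> [|//] b x _ Wx.
have : x \in [:: s'; s; p; q].
  apply: (row_support (weighing4_tr wW) us _ _ Wx) => // y; rewrite !inE => /or4P[] /eqP->;
    by case: b {Wx} => //=; rewrite cols // mulf_neq0 // oppr_eq0 unimod_neq0.
by rewrite !inE => /or4P[] /eqP->;
    [exists 1%N, true|exists 1%N, false|exists 0%N, false|exists 0%N, true].
Qed.

Lemma E_component p q j0 : p != q -> W p j0 != 0 ->
  (forall j, W p j != 0 -> W q j != 0) ->
  exists m x f g u v, [/\ (1 < m)%N, `|x| = 1 & summand W (2 * m) (E_entry m x) f g u v].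
Proof.
move=> pq pj sub; have [p' [q' [e [e' r1]]]] := rank1_same_support wW pq pj sub.
by have [r [c [u [v ch]]]] := chain_start r1; apply: chain_component ch.
Qed.

End ChainStep.

(** * The exhaustive search *)

(* (x, y) stands for x + y w, where w is a primitive cube root of unity. *)
Definition eisenstein : Type := int * int.
Definition eis_zero : eisenstein := (0, 0).
Definition eis_one : eisenstein := (1, 0).
(* The operations of [int] are named directly rather than through its ring
   structure, which is slow to unfold in kernel computations. *)
Definition eis_add (y z : eisenstein) : eisenstein :=
  (intZmod.addz y.1 z.1, intZmod.addz y.2 z.2).
Definition eis_mul (y z : eisenstein) : eisenstein :=
  let bd := intRing.mulz y.2 z.2 in
  (intZmod.addz (intRing.mulz y.1 z.1) (intZmod.oppz bd),
   intZmod.addz (intZmod.addz (intRing.mulz y.1 z.2) (intRing.mulz y.2 z.1))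
     (intZmod.oppz bd)).
Definition eis_conj (z : eisenstein) : eisenstein :=
  (intZmod.addz z.1 (intZmod.oppz z.2), intZmod.oppz z.2).
(** The successive powers of [1 + w], hence all sixth roots of unity. *)
Definition eis_units : seq eisenstein :=
  [:: (1, 0); (1, 1); (0, 1); (-1, 0); (-1, -1); (0, -1)].

Definition eis_entry (P : seq (seq eisenstein)) (i j : nat) : eisenstein :=
  nth eis_zero (nth [::] P i) j.
Definition eis_nz (z : eisenstein) : bool :=
  if z is (Posz 0, Posz 0) then false else true.

Fixpoint masks (l k : nat) : seq (seq bool) :=
  if l is l'.+1 then
    map (cons false) (masks l' k) ++
    (if k is k'.+1 then map (cons true) (masks l' k') else [::])
  else [:: [::]].

Definition overlap l (S : nat -> bool) (s : seq eisenstein) : nat :=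
  count (fun j => S j && eis_nz (nth eis_zero s j)) (iota 0 l).

(** [D] collects the columns where the new row is known to have a sixth root of unity; a column of
    its support joins when some row of [P] meets both it and a member of [D]. *)
Definition grow l (S : nat -> bool) (P : seq (seq eisenstein)) (D : seq bool)
    : seq bool :=
  mkseq (fun j => nth false D j || S j && has (fun s =>
    eis_nz (nth eis_zero s j) && has (fun j' =>
      nth false D j' && eis_nz (nth eis_zero s j')) (iota 0 l)) P) l.

(** A mask has at most four columns including [c0], so four rounds reach everything that can be
    reached. *)
Definition mask_connected l (S : nat -> bool) P c0 : bool :=
  let D := iter 4 (grow l S P) (mkseq (eq_op^~ c0) l) in
  all (fun j => S j ==> nth false D j) (iota 0 l).

Fixpoint all_choices (T : Type) (opts : seq (seq T)) : seq (seq T) :=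
  if opts is o :: opts' then
    let rest := all_choices opts' in
    flatten [seq [seq z :: zs | zs <- rest] | z <- o]
  else [:: [::]].

(** The new row is scaled to have 1 in column [c0]. *)
Definition entry_options l (S : nat -> bool) c0 : seq (seq eisenstein) :=
  mkseq (fun j => if j == c0 then [:: eis_one]
                  else if S j then eis_units else [:: eis_zero]) l.

Definition eis_orth l (y z : seq eisenstein) : bool :=
  ~~ eis_nz (foldr (fun j t =>
    if ~~ eis_nz (nth eis_zero y j) then t
    else if ~~ eis_nz (nth eis_zero z j) then t
    else eis_add (eis_mul (nth eis_zero y j) (eis_conj (nth eis_zero z j))) t) eis_zero (iota 0 l)).

Definition col_weight (P : seq (seq eisenstein)) j : nat :=
  count (fun s => eis_nz (nth eis_zero s j)) P.

(** Rows recorded before a column was added are shorter than [l], and [nth] reads the missing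
    entries as zero. Testing these conditions during the search spares a proof that they are
    invariant. *)
Definition admissible_state l (P : seq (seq eisenstein)) : bool :=
  all (fun s => [&& (size s <= l)%N,
                 count (fun j => eis_nz (nth eis_zero s j)) (iota 0 l) == 4%N &
                 all (fun z => eis_nz z ==> (z \in eis_units)) s]) P
  && all (fun j => 0 < col_weight P j)%N (iota 0 l).

Fixpoint first_some (A B : Type) (f : A -> option B) (s : seq A) : option B :=
  if s is x :: s' then if f x is Some y then Some y else first_some f s' else None.

(* The result is not trusted but checked by [copy_certificate]. *)
Fixpoint find_copy (l : nat) (P todo : seq (seq eisenstein))
    (rows : seq (nat * eisenstein)) (cols : seq (nat * (nat * eisenstein)))
    : option (seq (nat * eisenstein) * seq (nat * (nat * eisenstein))) :=
  if todo is q :: todo' then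
    let new := [seq j <- iota 0 l | eis_nz (nth eis_zero q j) && (j \notin unzip1 cols)] in
    first_some (fun p =>
      let fresh := [seq c <- iota 0 l | eis_nz (eis_entry P p c)
                                       && (c \notin unzip1 (unzip2 cols))] in
      if (p \in unzip1 rows) || (size fresh != size new) then None else
      first_some (fun u =>
        if all (fun t => eis_entry P p t.2.1
                  == eis_mul (eis_mul u t.2.2) (nth eis_zero q t.1)) cols
        then first_some (fun s =>
          find_copy l P todo' (rcons rows (p, u))
            (cols ++ [seq (t.1, (t.2, eis_mul (eis_entry P p t.2)
                       (eis_conj (eis_mul u (nth eis_zero q t.1))))) | t <- zip new s]))
          (permutations fresh)
        else None) (if rows is [::] then [:: eis_one] else eis_units))
      (iota 0 l)
  else Some (rows, cols).

Definition copy_certificate l (P T : seq (seq eisenstein))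
    (rows cols : seq (nat * eisenstein)) : bool :=
  [&& (size P == l) && (size T == l), size rows == l, size cols == l,
      uniq (unzip1 rows) && all (gtn l) (unzip1 rows),
      uniq (unzip1 cols) && all (gtn l) (unzip1 cols),
      all (mem eis_units) (unzip2 rows) && all (mem eis_units) (unzip2 cols) &
      all (fun i => all (fun j =>
        let r := nth (0%N, eis_zero) rows i in let c := nth (0%N, eis_zero) cols j in
        eis_entry P r.1 c.1 == eis_mul (eis_mul r.2 c.2) (eis_entry T i j))
      (iota 0 l)) (iota 0 l)].

(** [find_copy] lists columns in order of discovery, each tagged with its pattern column; they are
    sorted into pattern order for the certificate. *)
Definition copy_of l (P T : seq (seq eisenstein)) : bool :=
  if find_copy l P T [::] [::] is Some (rows, cols) then
    copy_certificate l P T rows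
      [seq head (0%N, eis_zero) [seq t.2 | t <- cols & t.1 == j] | j <- iota 0 l]
  else false.

Section Patterns.
Let o : eisenstein := eis_zero.
Let p : eisenstein := eis_one.
Let m : eisenstein := (-1, 0).
Let a : eisenstein := (0, 1).
Let b : eisenstein := (-1, -1).
Let ma : eisenstein := (0, -1).
Let mb : eisenstein := (1, 1).

Definition W5_pattern := [:: [:: p; p; p; p; o]; [:: p; a; b; o; p]; [:: p; b; o; a; b];
  [:: p; o; a; b; a]; [:: o; p; b; a; a]].

Definition W6_pattern := [:: [:: p; p; p; p; o; o]; [:: p; a; b; o; p; o];
  [:: p; b; a; o; o; p]; [:: p; o; o; m; m; m]; [:: o; p; o; m; mb; ma];
  [:: o; o; p; m; ma; mb]].

Definition W7_pattern := [:: [:: p; p; p; p; o; o; o]; [:: p; m; o; o; p; p; o];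
  [:: p; o; m; o; m; o; p]; [:: p; o; o; m; o; m; m]; [:: o; p; m; o; o; p; m];
  [:: o; p; o; m; p; o; p]; [:: o; o; p; m; m; p; o]].

Definition W8_pattern := [:: [:: p; p; p; p; o; o; o; o]; [:: p; m; o; o; p; p; o; o];
  [:: p; o; m; o; m; o; p; o]; [:: p; o; o; m; o; m; m; o]; [:: o; p; m; o; p; o; o; p];
  [:: o; p; o; m; o; p; o; m]; [:: o; o; p; m; o; o; p; p]; [:: o; o; o; o; p; m; p; m]].
End Patterns.

Definition sporadic_patterns := [:: W5_pattern; W6_pattern; W7_pattern; W8_pattern].

Definition is_sporadic l (P : seq (seq eisenstein)) : bool :=
  has (copy_of l P) [seq T <- sporadic_patterns | size T == l].
Arguments is_sporadic : simpl never.

Definition filter_all (A B : Type) (r : A -> B -> bool) (s : seq A) (t : seq B) :=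
  foldr (fun x => filter (r x)) t s.

Definition extension_masks l (P : seq (seq eisenstein)) c0 : seq (seq bool) :=
  filter_all (fun s mask => overlap l (nth false mask) s \in [:: 0; 2; 3]%N) P
    [seq mask <- masks l 4 | nth false mask c0].

Definition extension_rows l (P : seq (seq eisenstein)) (mask : seq bool) c0 :=
  filter_all (fun s z => eis_orth l z s) P
    (all_choices (entry_options l (nth false mask) c0)).

(* Some row not in P meets a column of weight less than 4, and it meets each row
   of P in 0, 2 or 3 places. Conditionals rather than boolean connectives, which
   are strict under [vm_compute], guard the recursive calls. *)
Fixpoint search (n l : nat) (P : seq (seq eisenstein)) : bool :=
  if n isn't n'.+1 then false else
  if ~~ admissible_state l P then false else
  if [seq j <- iota 0 l | (col_weight P j < 4)%N] is c0 :: _ then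
    all (fun mask =>
      if mask_connected l (nth false mask) P c0 then
        let d := (4 - count id mask)%N in
        all (fun z => search n' (l + d) (rcons P (z ++ nseq d eis_one)))
          (extension_rows l P mask c0)
      else false) (extension_masks l P c0)
  else is_sporadic l P.

(** The start state is a single row scaled to four ones. Each call adds one row, and no branch
    exceeds eight rows, so the fuel 9 is not exhausted. *)
Lemma search_true : search 9 4 [:: nseq 4 eis_one].
Proof. by vm_cast_no_check (erefl true). Qed.

Lemma eis_nzE z : eis_nz z = (z != eis_zero).
Proof. by case: z => [[[|x]|x] [[|y]|y]]. Qed.

(** * Eisenstein integers as complex numbers *)

Section Eisenstein.

Variables (C : numClosedFieldType) (w : C).
Hypothesis w_root : w ^+ 2 + w + 1 = 0.

Definition eis_val (z : eisenstein) : C := z.1%:~R + z.2%:~R * w.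

Let w2 : w * w = - 1 - w.
Proof. by apply/eqP; rewrite -subr_eq0 -w_root; apply/eqP; ring. Qed.

Lemma cube_root_unimod : `|w| = 1.
Proof.
have w3 : w ^+ 3 = 1.
  by apply/eqP; rewrite -subr_eq0; apply/eqP; transitivity ((w - 1) * (w ^+ 2 + w + 1));
    [ring | rewrite w_root mulr0].
by apply: (@pexpIrn _ 3) => //; rewrite ?nnegrE ?normr_ge0 ?ler01 // -normrX w3 normr1 expr1n.
Qed.

Lemma cube_root_conj : w^* = - 1 - w.
Proof.
have w0 := unimod_neq0 cube_root_unimod.
apply: (mulfI w0); rewrite (unimod_mulJ cube_root_unimod) mulrBr w2; ring.
Qed.

Lemma eis_val0 : eis_val eis_zero = 0. Proof. by rewrite /eis_val mul0r addr0. Qed.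
Lemma eis_val1 : eis_val eis_one = 1. Proof. by rewrite /eis_val mul0r addr0. Qed.

Lemma eis_valD y z : eis_val (eis_add y z) = eis_val y + eis_val z.
Proof.
rewrite (_ : eis_add y z = (y.1 + z.1, y.2 + z.2)) // /eis_val /= !intrD; ring.
Qed.

Lemma eis_valM y z : eis_val (eis_mul y z) = eis_val y * eis_val z.
Proof.
have -> : eis_mul y z = (y.1 * z.1 - y.2 * z.2, y.1 * z.2 + y.2 * z.1 - y.2 * z.2) by [].
rewrite /eis_val /= !(rmorphB, rmorphD, rmorphM) /=.
set a := y.1%:~R; set b := y.2%:~R; set c := z.1%:~R; set d := z.2%:~R.
by transitivity (a * c + (a * d + b * c) * w + b * d * (w * w)); [rewrite w2|]; ring.
Qed.

Lemma eis_valJ z : eis_val (eis_conj z) = (eis_val z)^*.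
Proof.
have -> : eis_conj z = (z.1 - z.2, - z.2) by [].
by rewrite /eis_val /= [RHS]rmorphD [in RHS]rmorphM /= !rmorph_int cube_root_conj
  rmorphB rmorphN /=; ring.
Qed.

(** Multiplying by the conjugate gives the integer norm [N = x^2 - xy + y^2], which is definite
    since [4N = (2x - y)^2 + 3y^2]. *)
Lemma eis_val_eq0 z : (eis_val z == 0) = (z == eis_zero).
Proof.
apply/eqP/eqP => [z0|->]; last exact: eis_val0.
have : eis_val (eis_mul z (eis_conj z)) = 0 by rewrite eis_valM z0 mul0r.
case: z {z0} => x y.
have -> : eis_mul (x, y) (eis_conj (x, y)) =
    (x * (x - y) - y * - y, x * - y + y * (x - y) - y * - y) by [].
rewrite /eis_val /=.
have -> : x * - y + y * (x - y) - y * - y = 0 by ring.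
rewrite mul0r addr0 => /eqP; rewrite intr_eq0 => /eqP xy.
have : (2 * x - y) ^+ 2 + 3 * y ^+ 2 = 0 by rewrite -[RHS](mulr0 4) -xy; ring.
have y_ge0 : 0 <= 3 * y ^+ 2 by rewrite mulr_ge0 ?sqr_ge0.
move/eqP; rewrite (paddr_eq0 (sqr_ge0 _) y_ge0) sqrf_eq0 (mulf_eq0 3) sqrf_eq0 /=.
by case/andP=> /eqP e /eqP y0; move: e; rewrite y0 => e; congr (_, _); lia.
Qed.

Lemma eis_unit_unimod z : z \in eis_units -> `|eis_val z| = 1.
Proof.
move=> zu; have : eis_mul z (eis_conj z) = eis_one.
  by apply/eqP; move: z zu; apply/allP.
move/(congr1 eis_val); rewrite eis_valM eis_valJ eis_val1 -normCK => n1.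
by apply: (@pexpIrn _ 2) => //; rewrite ?nnegrE ?normr_ge0 ?ler01 // n1 expr1n.
Qed.

Lemma eis_unit_expr6 z : z \in eis_units -> eis_val z ^+ 6 = 1.
Proof.
move=> zu; have : iter 5 (eis_mul z) z = eis_one by apply/eqP; move: z zu; apply/allP.
by move/(congr1 eis_val); rewrite /= !eis_valM eis_val1 => <-; ring.
Qed.

Lemma expr6_eis_unit t : t ^+ 6 = 1 -> exists2 z, z \in eis_units & eis_val z = t.
Proof.
move=> t6; have : (t - 1) * (t + 1) * (t - w) * (t + 1 + w) * (t + w) * (t - 1 - w) = 0.
  have -> : 0 = t ^+ 6 - 1 :> C by rewrite t6 subrr.
  have f1 : (t - w) * (t + 1 + w) = t ^+ 2 + t + 1.
    by transitivity (t ^+ 2 + t - w - w * w); [ring | rewrite w2; ring].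
  have f2 : (t + w) * (t - 1 - w) = t ^+ 2 - t + 1.
    by transitivity (t ^+ 2 - t - w - w * w); [ring | rewrite w2; ring].
  transitivity ((t - 1) * (t + 1) * ((t - w) * (t + 1 + w)) * ((t + w) * (t - 1 - w))).
    by ring.
  by rewrite f1 f2; ring.
move/eqP; rewrite !mulf_eq0 -!orbA.
case/or4P=> [||| /or3P[]]; rewrite ?subr_eq0 ?addr_eq0 => /eqP tE.
- by exists (1, 0) => //; rewrite tE /eis_val /=; ring.
- by exists (-1, 0) => //; rewrite tE /eis_val /=; ring.
- by exists (0, 1) => //; rewrite tE /eis_val /=; ring.
- by exists (-1, -1) => //; rewrite -[t](addrK 1) tE /eis_val /=; ring.
- by exists (0, -1) => //; rewrite tE /eis_val /=; ring.
- by exists (1, 1) => //; rewrite -[t](subrK 1) tE /eis_val /=; ring.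
Qed.

End Eisenstein.

(** * Soundness of the search *)

Lemma mem_filter_all (A : Type) (B : eqType) (r : A -> B -> bool) s t x :
  (x \in filter_all r s t) = all (r^~ x) s && (x \in t).
Proof. by elim: s => //= y s IH; rewrite mem_filter IH andbA. Qed.

Lemma mem_masks l k s : size s = l -> (count id s <= k)%N -> s \in masks l k.
Proof.
elim: l k s => [|l IH] k [|b s] //= [sl]; rewrite mem_cat.
case: b => /=; last first.
  by move=> sk; rewrite (map_f (cons false)) ?IH.
case: k => [|k] //; rewrite add1n ltnS => sk.
by rewrite (map_f (cons true)) ?IH ?orbT.
Qed.

Lemma mem_all_choices (T : eqType) (opts : seq (seq T)) x0 z :
  size z = size opts ->
  (forall j, (j < size opts)%N -> nth x0 z j \in nth [::] opts j) ->
  z \in all_choices opts.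
Proof.
elim: opts z => [|o opts IH] [|x z] //= [sz] H.
apply/flattenP; exists [seq x :: zs | zs <- all_choices opts].
  by apply/mapP; exists x => //; apply: (H 0%N).
by rewrite map_f // IH // => j jl; apply: (H j.+1).
Qed.

Lemma seq_choice (T : Type) (x0 : T) (Q : nat -> T -> Prop) l :
  (forall j, (j < l)%N -> exists x, Q j x) ->
  exists2 s, size s = l & forall j, (j < l)%N -> Q j (nth x0 s j).
Proof.
elim: l => [|l IH] H; first by exists [::].
have [s sl sQ] := IH (fun j jl => H j (ltnW jl)).
have [x Qx] := H l (ltnSn l); exists (rcons s x); first by rewrite size_rcons sl.
move=> j; rewrite ltnS leq_eqVlt nth_rcons sl => /orP[/eqP->|jl]; last by rewrite jl; apply: sQ.
by rewrite ltnn eqxx.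
Qed.

Lemma count_iota_nth (T : Type) (x0 : T) (a : pred T) s :
  count (fun j => a (nth x0 s j)) (iota 0 (size s)) = count a s.
Proof. by rewrite -[in RHS](mkseq_nth x0 s) /mkseq count_map. Qed.

Section InjectiveSegment.

Variables (T : eqType) (c : nat -> T) (l : nat).
Hypothesis c_inj : forall i j, (i < l)%N -> (j < l)%N -> c i = c j -> i = j.

Lemma segment_uniq (a : pred nat) : uniq [seq c j | j <- iota 0 l & a j].
Proof.
rewrite map_inj_in_uniq ?filter_uniq ?iota_uniq // => i j.
by rewrite !mem_filter !mem_iota /= => /andP[_ il] /andP[_ jl]; apply: c_inj.
Qed.

Lemma segmentP (a : pred nat) x :
  reflect (exists j, [/\ (j < l)%N, a j & x = c j]) (x \in [seq c j | j <- iota 0 l & a j]).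
Proof.
apply: (iffP mapP) => [[j]|[j [jl aj ->]]].
  by rewrite mem_filter mem_iota /= => /andP[aj jl] ->; exists j.
by exists j => //; rewrite mem_filter mem_iota aj.
Qed.

Lemma segment_size (a : pred nat) : size [seq c j | j <- iota 0 l & a j] = count a (iota 0 l).
Proof. by rewrite size_map size_filter. Qed.

End InjectiveSegment.

Section SearchSoundness.

Variables (C : numClosedFieldType) (w : C).
Hypothesis w_root : w ^+ 2 + w + 1 = 0.
Variables (I J : finType) (W : I -> J -> C).
Hypothesis wW : weighing4 W.
Hypothesis no_equal_support : forall p q j0, p != q -> W p j0 != 0 ->
  ~ (forall j, W p j != 0 -> W q j != 0).

Local Notation val := (eis_val w).

Record realizes l (P : seq (seq eisenstein)) (r : nat -> I) (c : nat -> J)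
    (u v : nat -> C) : Prop := Realizes {
  rz_row_inj : forall i i', (i < size P)%N -> (i' < size P)%N -> r i = r i' -> i = i';
  rz_col_inj : forall j j', (j < l)%N -> (j' < l)%N -> c j = c j' -> j = j';
  rz_row_unit : forall i, (i < size P)%N -> `|u i| = 1;
  rz_col_unit : forall j, (j < l)%N -> `|v j| = 1;
  rz_entry : forall i j, (i < size P)%N -> (j < l)%N ->
    W (r i) (c j) = u i * v j * val (eis_entry P i j) }.

Section NewRow.

Variables (l : nat) (P : seq (seq eisenstein)).
Variables (r : nat -> I) (c : nat -> J) (u v : nat -> C).
Hypothesis real : realizes l P r c u v.
Hypothesis adm : admissible_state l P.

Let val_nz z : (val z != 0) = eis_nz z.
Proof. by rewrite (eis_val_eq0 w_root) eis_nzE. Qed.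

Lemma state_row k : (k < size P)%N ->
  [/\ (size (nth [::] P k) <= l)%N,
      count (fun j => eis_nz (eis_entry P k j)) (iota 0 l) = 4%N &
      forall j, eis_nz (eis_entry P k j) -> eis_entry P k j \in eis_units].
Proof.
move=> kP; have /andP[/allP/(_ _ (mem_nth [::] kP))/and3P[sz /eqP c4 /allP un] _] := adm.
split=> // j nz; rewrite /eis_entry; have [jl|jl] := ltnP j (size (nth [::] P k)).
  by have /implyP := un _ (mem_nth eis_zero jl); apply.
by move: nz; rewrite /eis_entry nth_default.
Qed.

Lemma entry_nz i j : (i < size P)%N -> (j < l)%N ->
  (W (r i) (c j) != 0) = eis_nz (eis_entry P i j).
Proof.
move=> iP jl; rewrite (rz_entry real) // mulf_eq0 negb_or val_nz mulf_neq0 //;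
  by apply: unimod_neq0; rewrite ?(rz_row_unit real) ?(rz_col_unit real).
Qed.

(** A recorded row already shows four nonzero entries, so [W] has no others in it. *)
Lemma known_row_closed k y : (k < size P)%N -> W (r k) y != 0 ->
  exists j, [/\ (j < l)%N, eis_nz (eis_entry P k j) & y = c j].
Proof.
move=> kP Wy; have [_ c4 _] := state_row kP.
apply/(@segmentP _ c l (fun j => eis_nz (eis_entry P k j))).
apply: (row_support wW _ _ _ Wy).
- exact: segment_uniq (rz_col_inj real) _.
- by rewrite segment_size.
- by move=> x /segmentP[j [jl nz ->]]; rewrite entry_nz.
Qed.

Lemma known_col_size j :
  size [seq r k | k <- iota 0 (size P) & eis_nz (eis_entry P k j)] = col_weight P j.
Proof. by rewrite segment_size; apply: count_iota_nth. Qed.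

Lemma col_witness j : (j < l)%N -> exists i, W i (c j) != 0.
Proof.
move=> jl; have /andP[_ /allP/(_ j)] := adm; rewrite mem_iota => /(_ jl).
rewrite /col_weight -has_count => /hasP[s /(nthP [::])[k kP <-] nz].
by exists (r k); rewrite entry_nz.
Qed.

Lemma new_row_exists j : (j < l)%N -> (col_weight P j < 4)%N ->
  exists2 i, W i (c j) != 0 & forall k, (k < size P)%N -> i <> r k.
Proof.
move=> jl; rewrite -known_col_size //; have [i0 Wi0] := col_witness jl.
case/(card4_extend (wt_col wW Wi0)) => i; rewrite inE => Wi new; exists i => // k kP ik.
by move/segmentP: new; apply; exists k; split; rewrite // -entry_nz // -ik.
Qed.

Lemma full_col_closed j i : (j < l)%N -> (4 <= col_weight P j)%N -> W i (c j) != 0 ->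
  exists2 k, (k < size P)%N & i = r k.
Proof.
move=> jl j4 Wi; set s := [seq r k | k <- iota 0 (size P) & eis_nz (eis_entry P k j)].
have us : uniq s := segment_uniq (rz_row_inj real) _.
have sW : {subset s <= [pred i' | W i' (c j) != 0]}.
  by move=> x /segmentP[k [kP nz ->]]; rewrite inE entry_nz.
have s4 : size s = 4%N.
  have := card4_size_le (wt_col wW Wi) us sW.
  by rewrite known_col_size // => le4; apply/eqP; rewrite eqn_leq le4.
by have /segmentP[k [kP _ ->]] := card4_subset (wt_col wW Wi) us sW s4 Wi; exists k.
Qed.

Variables (i : I) (c0 : nat).
Hypothesis i_new : forall k, (k < size P)%N -> i <> r k.
Hypothesis c0l : (c0 < l)%N.
Hypothesis W0 : W i (c c0) != 0.

(** [kappa] is the phase of the new row, chosen so that its normalized form [T] takes the value 1 at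
    [c0]. *)
Let kappa := W i (c c0) / v c0.
Let T j := W i (c j) / (v j * kappa).

Let kappa1 : `|kappa| = 1.
Proof. by rewrite normrM normfV (wt_entry wW W0) (rz_col_unit real) ?divr1. Qed.

Let v0 j : (j < l)%N -> v j != 0.
Proof. by move=> jl; apply/unimod_neq0/(rz_col_unit real). Qed.

Let W_T j : (j < l)%N -> W i (c j) = kappa * v j * T j.
Proof.
by move=> jl; rewrite /T [RHS]mulrC [kappa * v j]mulrC divfK // mulf_neq0 ?v0 ?unimod_neq0.
Qed.

Let T_nz j : (j < l)%N -> (T j != 0) = (W i (c j) != 0).
Proof.
move=> jl; have k0 : kappa * v j != 0 by rewrite mulf_neq0 ?v0 ?unimod_neq0.
by rewrite W_T // [_ * T j == 0]mulf_eq0 (negPf k0).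
Qed.

Let T_unit j : (j < l)%N -> T j != 0 -> `|T j| = 1.
Proof.
move=> jl; rewrite T_nz // => Wj; rewrite normrM normfV normrM kappa1 mulr1.
by rewrite (wt_entry wW Wj) (rz_col_unit real) ?divr1.
Qed.

Let T_c0 : T c0 = 1.
Proof. by rewrite /T /kappa mulrCA divff ?v0 // mulr1 divff. Qed.

Let T_orth k : (k < size P)%N ->
  \sum_(j <- iota 0 l) T j * (val (eis_entry P k j))^* = 0.
Proof.
move=> kP; have ik : i != r k by apply/eqP/i_new.
have u1 := unimod_mulJ (rz_row_unit real kP).
have H : \sum_(j <- iota 0 l) W i (c j) * (W (r k) (c j))^* = 0.
  rewrite -(big_map c predT (fun y => W i y * (W (r k) y)^*)).
  apply: row_orth_seqr => //.
    by have := segment_uniq (rz_col_inj real) predT; rewrite filter_predT.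
  by move=> y /(known_row_closed kP)[j [jl _ ->]]; rewrite map_f ?mem_iota.
apply: (mulfI (unimod_neq0 kappa1)).
apply: (mulfI (x := (u k)^*)); first by rewrite conjC_eq0 unimod_neq0 ?(rz_row_unit real).
rewrite !mulr0 -[RHS]H !mulr_sumr [in LHS]big_seq [in RHS]big_seq.
apply: eq_bigr => j; rewrite mem_iota => /= jl.
rewrite (rz_entry real) // W_T // !rmorphM /=.
have v1 := unimod_mulJ (rz_col_unit real jl).
transitivity ((u k)^* * (kappa * (T j * (val (eis_entry P k j))^*)) * (v j * (v j)^*)).
  by rewrite v1 mulr1.
ring.
Qed.

Let meets k j := (T j != 0) && eis_nz (eis_entry P k j).

Let terms k := [seq T j * (val (eis_entry P k j))^* | j <- iota 0 l & meets k j].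

Let entry_expr6 k j : (k < size P)%N -> eis_nz (eis_entry P k j) ->
  `|(val (eis_entry P k j))^*| = 1 /\ (val (eis_entry P k j))^* ^+ 6 = 1.
Proof.
move=> kP nz; have [_ _ /(_ j nz) un] := state_row kP.
rewrite norm_conjC (eis_unit_unimod w_root un); split=> //.
by rewrite -rmorphXn /= (eis_unit_expr6 w_root un) rmorph1.
Qed.

Let terms_unit k : (k < size P)%N -> {in terms k, forall t, `|t| = 1}.
Proof.
move=> kP t /mapP[j]; rewrite mem_filter mem_iota => /= /andP[/andP[Tj nz] jl] ->.
by have [e1 _] := entry_expr6 kP nz; rewrite normrM e1 T_unit ?mulr1.
Qed.

Let terms_sum k : (k < size P)%N -> \sum_(t <- terms k) t = 0.
Proof.
move=> kP; rewrite big_map big_filter -[RHS](T_orth kP) big_mkcond; apply: eq_bigr => j _.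
case: ifP => // /negbT; rewrite negb_and negbK => /orP[/eqP->|]; first by rewrite mul0r.
by rewrite -val_nz negbK => /eqP->; rewrite rmorph0 mulr0.
Qed.

Let overlapE k : overlap l (fun j => T j != 0) (nth [::] P k) = size (terms k).
Proof. by rewrite size_map size_filter. Qed.

(** Four common places would put the whole support of a known row inside that of the new one. *)
Let overlap_ne4 k : (k < size P)%N -> size (terms k) <> 4%N.
Proof.
move=> kP; rewrite size_map size_filter => c4; have [_ e4 _] := state_row kP.
have sub j : (j < l)%N -> eis_nz (eis_entry P k j) -> T j != 0.
  move=> jl nz; apply: contraT => Tj.
  have := count_predC (fun j => T j != 0) [seq j <- iota 0 l | eis_nz (eis_entry P k j)].
  rewrite size_filter e4 count_filter (c4 : count (predI _ _) _ = 4%N) => /eqP.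
  rewrite -[X in _ == X]addn0 eqn_add2l -leqn0 leqNgt -has_count => /hasP[].
  by exists j; rewrite // mem_filter nz mem_iota.
have [j [jl nz]] : exists j, (j < l)%N /\ eis_nz (eis_entry P k j).
  have : has (fun j => eis_nz (eis_entry P k j)) (iota 0 l) by rewrite has_count e4.
  by case/hasP=> j; rewrite mem_iota => /= jl nz; exists j.
apply: (@no_equal_support (r k) i (c j)).
- by rewrite eq_sym; apply/eqP/i_new.
- by rewrite entry_nz.
by move=> y /(known_row_closed kP)[j' [j'l nz' ->]]; rewrite -T_nz ?sub.
Qed.

Let overlap_le3 k : (k < size P)%N -> (size (terms k) <= 3)%N.
Proof.
move=> kP; have := overlap_ne4 kP; have [_ e4 _] := state_row kP.
have : (size (terms k) <= 4)%N.
  by rewrite size_map size_filter -e4; apply: sub_count => j /andP[].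
lia.
Qed.

Lemma new_row_overlap k : (k < size P)%N ->
  overlap l (fun j => T j != 0) (nth [::] P k) \in [:: 0; 2; 3]%N.
Proof.
move=> kP; rewrite overlapE; have := overlap_le3 kP.
have [n1|] := eqVneq (size (terms k)) 1%N; last by case: (size _) => [|[|[|[|]]]].
have := terms_sum kP; have := terms_unit kP; case: (terms k) n1 => [|t []] // _.
rewrite big_seq1 => /(_ t (mem_head _ _))/unimod_neq0/eqP//.
Qed.

(** The terms of the inner product share their sixth power, and the factors from the known row drop
    out, being sixth roots of unity. *)
Lemma new_row_expr6 k j j' : (k < size P)%N -> (j < l)%N -> (j' < l)%N ->
  T j != 0 -> T j' != 0 -> eis_nz (eis_entry P k j) -> eis_nz (eis_entry P k j') ->
  T j ^+ 6 = T j' ^+ 6.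
Proof.
move=> kP jl jl' Tj Tj' nz nz'.
have tj a : (a < l)%N -> T a != 0 -> eis_nz (eis_entry P k a) ->
    T a * (val (eis_entry P k a))^* \in terms k.
  by move=> al Ta na; apply/map_f; rewrite mem_filter mem_iota /meets Ta na.
have := unimod_sum_expr6 (terms_unit kP) (overlap_le3 kP) (terms_sum kP)
  (tj _ jl Tj nz) (tj _ jl' Tj' nz').
by rewrite !exprMn (entry_expr6 kP nz).2 (entry_expr6 kP nz').2 !mulr1.
Qed.

(** The invariant [T j ^+ 6 = 1] starts from [T c0 = 1] and is carried along shared rows by each
    round of [grow]. *)
Lemma connected_expr6 j : mask_connected l (fun j => T j != 0) P c0 -> (j < l)%N ->
  T j != 0 -> T j ^+ 6 = 1.
Proof.
set S := fun j => T j != 0.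
pose inv D := forall j, (j < l)%N -> nth false D j -> T j != 0 /\ T j ^+ 6 = 1.
have inv0 : inv (mkseq (eq_op^~ c0) l).
  by move=> a al; rewrite nth_mkseq // => /eqP->; rewrite T_c0 oner_eq0 expr1n.
have invS D : inv D -> inv (grow l S P D).
  move=> iD a al; rewrite nth_mkseq // => /orP[/iD|/andP[Ta]]; first exact.
  case/hasP=> s /(nthP [::])[k kP <-] /andP[nz /hasP[b]]; rewrite mem_iota => /= bl.
  case/andP=> /(iD _ bl)[Tb b6] nzb; split=> //.
  by rewrite -b6; apply: (new_row_expr6 kP).
have inv4 : inv (iter 4 (grow l S P) (mkseq (eq_op^~ c0) l)).
  exact: (invS _ (invS _ (invS _ (invS _ inv0)))).
move=> /allP/(_ j); rewrite mem_iota => H jl Tj.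
by have /implyP/(_ Tj)/(inv4 _ jl)[] := H jl.
Qed.

Lemma new_row_weight : (count (fun j => T j != 0%R) (iota 0 l) <= 4)%N.
Proof.
rewrite -(@segment_size _ c l (fun j => T j != 0)).
apply: (card4_size_le (wt_row wW W0)); first exact: segment_uniq (rz_col_inj real) _.
by move=> x /segmentP[j [jl Tj ->]]; rewrite inE -T_nz.
Qed.

Lemma new_row_choice : mask_connected l (fun j => T j != 0) P c0 ->
  exists2 z, size z = l & forall j, (j < l)%N ->
    nth eis_zero z j \in nth [::] (entry_options l (fun j => T j != 0) c0) j /\
    val (nth eis_zero z j) = T j.
Proof.
move=> conn.
apply: (@seq_choice _ eis_zero (fun j x =>
  x \in nth [::] (entry_options l (fun j => T j != 0) c0) j /\ val x = T j)) => j jl.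
rewrite nth_mkseq //.
have [->|jc] := eqVneq j c0; first by exists eis_one; rewrite mem_head T_c0 eis_val1.
have [->|Tj] := eqVneq (T j) 0; first by exists eis_zero; rewrite mem_head eis_val0.
have [z zu zT] := expr6_eis_unit w_root (connected_expr6 conn jl Tj).
by exists z.
Qed.

Lemma new_row_orth k z : (k < size P)%N -> 
  (forall j, (j < l)%N -> val (nth eis_zero z j) = T j) ->
  eis_orth l z (nth [::] P k).
Proof.
move=> kP zT; rewrite /eis_orth -val_nz negbK; apply/eqP; rewrite -[RHS](T_orth kP).
have : {in iota 0 l, forall j, val (nth eis_zero z j) = T j}.
  by move=> j; rewrite mem_iota => /= jl; apply: zT.
elim: (iota 0 l) => [|j s IH] zs /=; first by rewrite big_nil eis_val0.
rewrite big_cons -IH; last by move=> a as_; apply: zs; rewrite inE as_ orbT.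
rewrite -(zs j (mem_head _ _)); case: ifPn => [|_].
  by rewrite -val_nz negbK => /eqP->; rewrite mul0r add0r.
case: ifPn => [|_]; last by rewrite eis_valD (eis_valM w_root) (eis_valJ w_root).
by rewrite -val_nz negbK => /eqP vz; rewrite -/(eis_entry P k j) in vz *;
  rewrite vz rmorph0 mulr0 add0r.
Qed.

(** The [d] nonzero entries of row [i] outside the known columns open new columns [E]. Known rows
    vanish there, and the free column phases turn the new entries into ones. *)
Lemma new_row_realizes z (d := (4 - count (fun j => T j != 0%R) (iota 0 l))%N) :
  size z = l -> (forall j, (j < l)%N -> val (nth eis_zero z j) = T j) ->
  exists r' c' u' v', realizes (l + d) (rcons P (z ++ nseq d eis_one)) r' c' u' v'.
Proof.
move=> zl zT.
set s := [seq c j | j <- iota 0 l & T j != 0].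
set E := [seq y <- enum [pred y | W i y != 0] | y \notin s].
have us : uniq s := segment_uniq (rz_col_inj real) _.
have Enew y j : y \in E -> (j < l)%N -> c j <> y.
  rewrite mem_filter mem_enum inE => /andP[/negP ys Wy] jl cE; apply: ys.
  by apply/segmentP; exists j; rewrite T_nz // cE.
have uE : uniq E by rewrite filter_uniq ?enum_uniq.
have sE : size E = d.
  have : perm_eq (s ++ E) (enum [pred y | W i y != 0]).
    apply: uniq_perm; rewrite ?enum_uniq // ?cat_uniq ?us ?uE ?andbT /=.
      by apply/hasPn => y; rewrite mem_filter => /andP[].
    move=> y; rewrite mem_cat mem_filter; case: (boolP (y \in s)) => //=.
    by case/segmentP=> j [jl Tj ->]; rewrite mem_enum inE -T_nz.
  move/perm_size; rewrite size_cat -cardE (wt_row wW W0) segment_size /d; lia.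
have WE y : y \in E -> W i y != 0 by rewrite mem_filter mem_enum => /andP[].
pose e j := nth (c c0) E (j - l).
have eE j : (l <= j)%N -> (j < l + d)%N -> e j \in E.
  by move=> lj jd; rewrite mem_nth // sE; lia.
exists (fun k => if (k < size P)%N then r k else i), (fun j => if (j < l)%N then c j else e j),
  (fun k => if (k < size P)%N then u k else kappa),
  (fun j => if (j < l)%N then v j else W i (e j) / kappa).
split; rewrite ?size_rcons.
- move=> k k' kP k'P; have [kl|kl] := ltnP k (size P); have [kl'|kl'] := ltnP k' (size P).
  + exact: rz_row_inj real _ _ kl kl'.
  + by move=> /esym/(i_new kl).
  + by move=> /(i_new kl').
  + by lia.
- move=> j j' jd j'd; have [jl|jl] := ltnP j l; have [jl'|jl'] := ltnP j' l.
  + exact: rz_col_inj real _ _ jl jl'.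
  + by move=> /(Enew _ _ (eE _ jl' j'd) jl).
  + by move=> /esym/(Enew _ _ (eE _ jl jd) jl').
  + move/eqP; rewrite /e nth_uniq ?sE //; lia.
- by move=> k kP; case: ltnP => // kl; apply: (rz_row_unit real).
- move=> j jd; case: ltnP => jl; first exact: (rz_col_unit real).
  by rewrite normrM normfV kappa1 divr1 (wt_entry wW) // WE // eE.
move=> k j kP jd; rewrite /eis_entry nth_rcons; have [kl|kl] := ltnP k (size P).
  have [jl|jl] := ltnP j l; first exact: rz_entry real _ _ kl jl.
  have [szk _ _] := state_row kl.
  rewrite nth_default ?eis_val0 ?mulr0; last exact: leq_trans szk jl.
  apply/eqP; apply: contraT => /(known_row_closed kl)[j' [jl' _ eE']].
  by case: (Enew _ _ (eE _ jl jd) jl').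
have -> : k == size P by lia.
rewrite nth_cat zl; have [jl|jl] := ltnP j l; first by rewrite zT ?W_T.
have lt : (j - l < d)%N by lia.
by rewrite nth_nseq lt eis_val1 mulr1 mulrC divfK ?unimod_neq0.
Qed.

(** The mask of the new row is listed in any case. As [search] fails on a disconnected mask,
    connectedness is available when the entries are to be found. *)
Lemma new_row_extends : exists2 mask, mask \in extension_masks l P c0 &
  mask_connected l (nth false mask) P c0 -> exists2 z, z \in extension_rows l P mask c0 &
  exists r' c' u' v', realizes (l + (4 - count id mask))
    (rcons P (z ++ nseq (4 - count id mask) eis_one)) r' c' u' v'.
Proof.
pose mask := mkseq (fun j => T j != 0) l; exists mask.
  rewrite mem_filter_all mem_filter mem_masks ?size_mkseq //; last first.
    by rewrite /mask count_map new_row_weight.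
  rewrite andbT nth_mkseq // T_c0 oner_eq0 andbT.
  apply/allP=> s /(nthP [::])[k kP <-].
  have := new_row_overlap kP; rewrite /overlap; set n := count _ _; set n' := count _ _.
  suff -> : n' = n by []; apply: eq_in_count => j; rewrite mem_iota => /= jl.
  by rewrite nth_mkseq.
have maskE j : j \in iota 0 l -> nth false mask j = (T j != 0).
  by rewrite mem_iota => /= jl; rewrite nth_mkseq.
have countE : count id mask = count (fun j => T j != 0) (iota 0 l) by rewrite /mask count_map.
have growE D : grow l (nth false mask) P D = grow l (fun j => T j != 0) P D.
  by apply/eq_in_map => j /maskE->.
have connE : mask_connected l (nth false mask) P c0 = mask_connected l (fun j => T j != 0) P c0.
  rewrite /mask_connected (eq_iter growE); apply: eq_in_all => j /maskE->//.
have optE : entry_options l (nth false mask) c0 = entry_options l (fun j => T j != 0) c0.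
  by apply/eq_in_map => j /maskE->.
rewrite connE countE => /new_row_choice[z zl zQ]; exists z.
  rewrite mem_filter_all; apply/andP; split.
    apply/allP=> s /(nthP [::])[k kP <-]; apply: new_row_orth => // j jl.
    by have [] := zQ j jl.
  apply: (@mem_all_choices _ _ eis_zero); rewrite ?optE ?size_mkseq // => j jl.
  by have [] := zQ j jl.
by apply: new_row_realizes => // j jl; have [] := zQ j jl.
Qed.

End NewRow.

(** Only the certificate is used, whatever [find_copy] did. *)
Lemma copy_summand l P r c u v T : realizes l P r c u v ->
  (forall k y, (k < size P)%N -> W (r k) y != 0 -> exists2 j, (j < l)%N & y = c j) ->
  (forall j x, (j < l)%N -> W x (c j) != 0 -> exists2 k, (k < size P)%N & x = r k) ->
  copy_of l P T ->
  exists f g u' v', summand W l (fun i j => val (eis_entry T i j)) f g u' v'.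
Proof.
move=> real rcl ccl; rewrite /copy_of; case: find_copy => [[rows cols0]|//].
move: [seq head _ _ | j <- _] => cols.
case/and5P=> /andP[/eqP szP _] /eqP sr /eqP sc /andP[ur /allP rl].
case/and3P=> /andP[uc /allP cl] /andP[/allP ru /allP cu] /allP ent.
set row := fun i => nth (0%N, eis_zero) rows i; set col := fun i => nth (0%N, eis_zero) cols i.
have row_lt i : (i < l)%N -> ((row i).1 < l)%N.
  by move=> il; apply: rl; apply/map_f/mem_nth; rewrite sr.
have col_lt i : (i < l)%N -> ((col i).1 < l)%N.
  by move=> il; apply: cl; apply/map_f/mem_nth; rewrite sc.
have row_u i : (i < l)%N -> (row i).2 \in eis_units.
  by move=> il; apply: ru; apply/map_f/mem_nth; rewrite sr.
have col_u i : (i < l)%N -> (col i).2 \in eis_units.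
  by move=> il; apply: cu; apply/map_f/mem_nth; rewrite sc.
(* A duplicate-free list of [l] numbers below [l] hits all of them; this transfers closure from the
   state to the reordered pattern. *)
have onto (s : seq (nat * eisenstein)) k : size s = l -> uniq (unzip1 s) ->
    {in unzip1 s, forall x, gtn l x} -> (k < l)%N ->
    exists2 i, (i < l)%N & k = (nth (0%N, eis_zero) s i).1.
  move=> ss us sl kl.
  have [||_ mem] := uniq_min_size (s1 := unzip1 s) (s2 := iota 0 l) us.
  - by move=> x /sl; rewrite mem_iota.
  - by rewrite size_iota size_map ss.
  have : k \in unzip1 s by rewrite mem mem_iota.
  case/(nthP 0%N)=> i; rewrite size_map ss => il <-; exists i => //.
  by rewrite (nth_map (0%N, eis_zero)) ?ss.
have row_inj (s : seq (nat * eisenstein)) x y : uniq (unzip1 s) -> (x < size s)%N ->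
    (y < size s)%N -> (nth (0%N, eis_zero) s x).1 = (nth (0%N, eis_zero) s y).1 -> x = y.
  move=> us xs ys; rewrite -!(nth_map _ 0%N fst) // => /eqP.
  by rewrite nth_uniq ?size_map // => /eqP.
exists (fun i => r (row i).1), (fun j => c (col j).1),
  (fun i => u (row i).1 * val (row i).2), (fun j => v (col j).1 * val (col j).2).
split.
- move=> x y xl yl re; apply: (row_inj rows); rewrite ?sr //.
  by apply: rz_row_inj real _ _ _ _ re; rewrite szP row_lt.
- move=> x y xl yl ce; apply: (row_inj cols); rewrite ?sc //.
  by apply: rz_col_inj real _ _ _ _ ce; rewrite col_lt.
- move=> x xl; rewrite normrM (rz_row_unit real) ?szP ?row_lt //.
  by rewrite (eis_unit_unimod w_root) ?mulr1 ?row_u.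
- move=> x xl; rewrite normrM (rz_col_unit real) ?col_lt //.
  by rewrite (eis_unit_unimod w_root) ?mulr1 ?col_u.
- move=> x y xl yl; rewrite (rz_entry real) ?szP ?row_lt ?col_lt //.
  have := ent x; rewrite mem_iota => /(_ xl)/allP/(_ y); rewrite mem_iota => /(_ yl)/eqP->.
  by rewrite !(eis_valM w_root); ring.
- move=> x y xl /rcl[|j jl ->]; first by rewrite szP row_lt.
  by have [i il ->] := onto cols j sc uc cl jl; exists i.
- move=> x y yl /(ccl _ _ (col_lt _ yl))[k]; rewrite szP => kl ->.
  by have [i il ->] := onto rows k sr ur rl kl; exists i.
Qed.

Lemma search_sound n l P r c u v : search n l P -> realizes l P r c u v ->
  exists T f g u' v', T \in sporadic_patterns /\
    summand W (size T) (fun i j => val (eis_entry T i j)) f g u' v'.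
Proof.
elim: n l P r c u v => //= n IH l P r c u v; case: ifP => // /negbFE adm.
case colsE: [seq j <- _ | _] => [|c0 cols] + real.
  (* No column of weight below 4 is left, so the state is closed in both directions and is a whole
     summand. *)
  rewrite /is_sporadic => /hasP[T]; rewrite mem_filter => /andP[/eqP sT Tin] cp.
  have full j : (j < l)%N -> (4 <= col_weight P j)%N.
    move=> jl; rewrite leqNgt; apply/negP => wj.
    by have : j \in [::] by rewrite -colsE mem_filter wj mem_iota.
  have [|j x jl Wx|f [g [u' [v' sm]]]] := copy_summand real _ _ cp.
  - by move=> k y kP /(known_row_closed real adm kP)[j [jl _ ->]]; exists j.
  - exact: (full_col_closed real jl (full _ jl) Wx).
  by exists T, f, g, u', v'; rewrite sT.
have : c0 \in [seq j <- iota 0 l | (col_weight P j < 4)%N] by rewrite colsE mem_head.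
rewrite mem_filter mem_iota => /= /andP[c0w c0l] /allP masksP.
have [i W0 i_new] := new_row_exists real adm c0l c0w.
have [mask /masksP] := new_row_extends real adm i_new c0l W0.
case: ifP => // conn /allP rowsP /(_ isT)[z /rowsP zs [r' [c' [u' [v' real']]]]].
exact: IH zs real'.
Qed.

Lemma sporadic_component i0 j0 : W i0 j0 != 0 ->
  exists T f g u v, T \in sporadic_patterns /\
    summand W (size T) (fun i j => val (eis_entry T i j)) f g u v.
Proof.
move=> W0; pose c j := nth j0 (enum [pred j | W i0 j != 0]) j.
have sz : size (enum [pred j | W i0 j != 0]) = 4%N by rewrite -cardE (wt_row wW W0).
have Wc j : (j < 4)%N -> W i0 (c j) != 0.
  move=> jl; have : c j \in [pred j | W i0 j != 0] by rewrite -mem_enum mem_nth ?sz.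
  by rewrite inE.
apply: (search_sound search_true (r := fun=> i0) (c := c) (u := fun=> 1)
  (v := fun j => W i0 (c j))); split=> [[|//] [|//] //|j j' jl jl'|i _|j jl|[|//] j _ jl].
- by move/eqP; rewrite nth_uniq ?sz ?enum_uniq // => /eqP.
- by rewrite normr1.
- by rewrite (wt_entry wW) ?Wc.
by rewrite /eis_entry (nth_nseq _ 4 eis_one) jl eis_val1 mulr1 mul1r.
Qed.

End SearchSoundness.

(** * Peeling off components *)

Section Peeling.

Variables (C : numClosedFieldType) (I J : finType) (W : I -> J -> C).
Hypothesis wW : weighing4 W.
Variables (k : nat) (M : nat -> nat -> C).
Variables (f : nat -> I) (g : nat -> J) (u v : nat -> C).
Hypothesis sm : summand W k M f g u v.

(** Zeroing rows is enough: the columns of a summand are nonzero only in its rows, so they vanish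
    too. *)
Definition peel (i : I) (j : J) : C := if i \in [seq f x | x <- iota 0 k] then 0 else W i j.

Lemma peel_col_neq i j : peel i j != 0 -> forall y, (y < k)%N -> j <> g y.
Proof.
rewrite /peel; case: ifP => [_|/negP ni]; first by rewrite eqxx.
move=> Wij y yk jE; apply: ni; move: Wij; rewrite jE => /(sm_col_closed sm yk)[x xk ->].
by rewrite map_f ?mem_iota.
Qed.

Lemma peel_row_neq i j : peel i j != 0 -> forall x, (x < k)%N -> i <> f x.
Proof.
rewrite /peel; case: ifP => [_|/negP ni]; first by rewrite eqxx.
by move=> _ x xk iE; apply: ni; rewrite iE map_f ?mem_iota.
Qed.

Lemma peel_eq i j : peel i j != 0 -> peel i j = W i j.
Proof. by rewrite /peel; case: ifP; rewrite ?eqxx. Qed.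

Lemma peel_eq_row i j : (forall x, (x < k)%N -> i <> f x) -> peel i j = W i j.
Proof.
rewrite /peel => H; case: ifP => // /mapP[x]; rewrite mem_iota => /= xk iE.
by case: (H x xk).
Qed.

Lemma peel_eq_col i j : (forall y, (y < k)%N -> j <> g y) -> peel i j = W i j.
Proof.
rewrite /peel => H; case: ifP => // /mapP[x]; rewrite mem_iota => /= xk iE.
apply/esym/eqP; apply: contraT; rewrite iE => /(sm_row_closed sm xk)[y yk jE].
by case: (H y yk).
Qed.

Lemma weighing4_peel : weighing4 peel.
Proof.
split.
- by move=> i j pij; rewrite peel_eq //; apply: (wt_entry wW); rewrite -peel_eq.
- move=> i j pij; rewrite -(wt_row wW (i := i) (j := j)) -?peel_eq //.
  by apply: eq_card => j'; rewrite !inE peel_eq_row //; apply: peel_row_neq pij.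
- move=> i j pij; rewrite -(wt_col wW (i := i) (j := j)) -?peel_eq //.
  by apply: eq_card => i'; rewrite !inE peel_eq_col //; apply: peel_col_neq pij.
- move=> i i' ii'; set s := [seq f x | x <- iota 0 k].
  have [iin|iout] := boolP (i \in s).
    by rewrite big1 // => j _; rewrite /peel iin mul0r.
  have [iin'|iout'] := boolP (i' \in s).
    by rewrite big1 // => j _; rewrite [peel i' j]/peel iin' conjC0 mulr0.
  rewrite -[RHS](wt_row_orth wW ii'); apply: eq_bigr => j _.
  by rewrite /peel (negPf iout) (negPf iout').
move=> j j' jj'; have [/hasP[y yk /eqP jE]|/hasPn jn] := boolP (has (fun y => j == g y) (iota 0 k)).
  rewrite big1 // => i _; have [->|pij] := eqVneq (peel i j) 0; first by rewrite mul0r.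
  by move: yk; rewrite mem_iota => yk; case: (peel_col_neq pij yk jE).
rewrite -[RHS](wt_col_orth wW jj'); apply: eq_bigr => i _.
have pW : peel i j = W i j.
  by apply: peel_eq_col => y yk jE; have := jn y; rewrite mem_iota yk jE eqxx => /(_ isT).
have [p0|pij] := eqVneq (peel i j) 0; first by rewrite -pW p0 !mul0r.
by rewrite pW (peel_eq_row (i := i) j') //; apply: peel_row_neq pij.
Qed.

End Peeling.

(** This separates components: peeled lines are zero, whereas each line of a block found later is
    nonzero. *)
Definition nonzero_lines (C : numClosedFieldType) k (M : nat -> nat -> C) :=
  (forall x, (x < k)%N -> exists2 y, (y < k)%N & M x y != 0) /\
  (forall y, (y < k)%N -> exists2 x, (x < k)%N & M x y != 0).

Lemma chain_entry_next (C : numClosedFieldType) i a b : chain_entry C i i.+1 a b != 0.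
Proof. by rewrite /chain_entry andbF eqxx signr_eq0. Qed.

Lemma E_entry_tr (C : numClosedFieldType) m (x : C) s t : E_entry m x s t = E_entry m x t s.
Proof. by rewrite /E_entry andbC chain_entry_tr; case: ifP => // _; rewrite mulrAC. Qed.

Lemma E_nonzero_lines (C : numClosedFieldType) m (x : C) : (1 < m)%N ->
  nonzero_lines (2 * m) (E_entry m x).
Proof.
move=> m1; have row s : (s < 2 * m)%N -> exists2 t, (t < 2 * m)%N & E_entry m x s t != 0.
  move=> sm; have [last|notlast] := eqVneq s./2 m.-1.
    (* In the last row pair the witness lies in the block to the left of the corner, in all others
       in the block to the right of the diagonal. *)
    exists (2 * m.-2)%N; first lia.
    have -> : E_entry m x s (2 * m.-2) =
        chain_entry C m.-2.+1 m.-2 (odd s) (odd (2 * m.-2)).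
      rewrite /E_entry mul2n doubleK; have -> : (m.-2 == m.-1) = false by lia.
      by rewrite andbF last; congr chain_entry; lia.
    by rewrite chain_entry_tr chain_entry_next.
  exists (2 * (s./2).+1)%N; first lia.
  by rewrite /E_entry (negPf notlast) andFb mul2n doubleK chain_entry_next.
by split=> // y /row[x' lt ne]; exists x'; rewrite // E_entry_tr.
Qed.

Lemma sporadic_nonzero_lines (C : numClosedFieldType) (w : C) T : w ^+ 2 + w + 1 = 0 ->
  T \in sporadic_patterns ->
  nonzero_lines (size T) (fun i j => eis_val w (eis_entry T i j)).
Proof.
move=> w_root Tin.
have : all (fun i => has (fun j => eis_nz (eis_entry T i j)) (iota 0 (size T))
       && has (fun j => eis_nz (eis_entry T j i)) (iota 0 (size T))) (iota 0 (size T)).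
  by move: T Tin; apply/allP.
move=> /allP H; split=> x xT; have := H x; rewrite mem_iota => /(_ xT)/andP[/hasP[y yT nz]].
  by move=> _; exists y; rewrite ?(eis_val_eq0 w_root) -?eis_nzE //; rewrite mem_iota in yT.
by case/hasP=> z zT nz'; exists z; rewrite ?(eis_val_eq0 w_root) -?eis_nzE //;
  rewrite mem_iota in zT.
Qed.

(** * The named blocks and the full decomposition *)

Section Blocks.

Variable R : realType.

(** The addition formulas give [w^3 = 1], and [w] is not 1 because [sin (2 pi / 3)] is positive. *)
Lemma omega_root : omega R ^+ 2 + omega R + 1 = 0.
Proof.
set w := omega R; set t : R := 2 * pi / 3.
have w2 : w * w = Complex (cos (t + t)) (sin (t + t)).
  apply/eqP; rewrite eq_complex cosD sinD /= -/t.
  by apply/andP; split; apply/eqP; ring.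
have w3 : w * w * w = 1.
  rewrite w2; transitivity (Complex (cos (t + t + t)) (sin (t + t + t)) : R[i]).
    apply/eqP; rewrite eq_complex (cosD (t + t)) (sinD (t + t)) /= -/t.
    by apply/andP; split; apply/eqP; ring.
  have -> : t + t + t = pi *+ 2 by rewrite /t; field.
  by rewrite cos2pi sin2pi.
have w1 : w - 1 != 0.
  rewrite subr_eq0 eq_complex /= negb_and; apply/orP; right.
  rewrite gt_eqF // sin_gt0_pi // divr_gt0 ?mulr_gt0 ?pi_gt0 //=.
  by rewrite ltr_pdivrMr // mulrC ltr_pM2l ?pi_gt0 // ltr_nat.
apply: (mulfI w1); rewrite mulr0; transitivity (w * w * w - 1); first by ring.
by rewrite w3 subrr.
Qed.

Definition block_ok (b : uw_block R) : bool :=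
  if b is BE m x then (1 < m)%N && unimodular x else true.

Lemma mx_of_rows_pattern n T i j :
  mx_of_rows n (map (map (eis_val (omega R))) T) i j = eis_val (omega R) (eis_entry T i j).
Proof.
have nth_map0 (A B : Type) (h : A -> B) x0 y0 s k : h x0 = y0 ->
    nth y0 (map h s) k = h (nth x0 s k).
  by move=> <-; elim: s k => [|x s IH] [|k] /=.
by rewrite mxE (nth_map0 _ _ _ [::]) // (nth_map0 _ _ _ eis_zero) // eis_val0.
Qed.

Lemma sporadic_block T : T \in sporadic_patterns -> exists b : uw_block R,
  [/\ block_ok b, block_size b = size T &
      forall i j, block_matrix b i j = eis_val (omega R) (eis_entry T i j)].
Proof.
(* One rewrite rule turning every value that occurs in a pattern into the literal entry of the
   matrix. *)
have valE : ((eis_val (omega R) (0, 0) = 0) * (eis_val (omega R) (1, 0) = 1) *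
  (eis_val (omega R) (-1, 0) = -1) * (eis_val (omega R) (0, 1) = omega R) *
  (eis_val (omega R) (-1, -1) = (omega R)^*) * (eis_val (omega R) (0, -1) = - omega R) *
  (eis_val (omega R) (1, 1) = - (omega R)^*))%type.
  by do ![split]; rewrite /eis_val ?(cube_root_conj omega_root) /=; ring.
rewrite !inE => /or4P[] /eqP->;
  [exists (@BW5 R)|exists (@BW6 R)|exists (@BW7 R)|exists (@BW8 R)]; split=> // i j;
  by rewrite -mx_of_rows_pattern /=; congr (mx_of_rows _ _ i j); rewrite /= !valE.
Qed.

(** The two descriptions test for the last diagonal block at different stages; for [m > 1] the cases
    are disjoint and the order is immaterial. *)
Lemma E_matrix_entry m (x : R[i]) i j : (1 < m)%N -> E_matrix m x i j = E_entry m x i j.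
Proof.
move=> m1; rewrite mxE /E_block /E_entry /chain_entry !divn2 !modn2.
have oddE (s : nat) : (inord (odd s) : 'I_2) = odd s :> nat by rewrite inordK //; case: odd.
case: ifP => [/andP[/eqP-> /eqP->]|nz].
  have -> : (0 == m.-1)%N = false by lia.
  by rewrite /= mxE !oddE; case: (odd i); case: (odd j).
have [jE|jE] := eqVneq (j./2) (i./2).+1.
  have -> : (i./2 == m.-1) && (j./2 == m.-1) = false by lia.
  by rewrite mxE !oddE; case: (odd i); case: (odd j).
have [iE|iE] := eqVneq (i./2) (j./2).+1.
  have -> : (i./2 == m.-1) && (j./2 == m.-1) = false by lia.
  by rewrite mxE !oddE; case: (odd i); case: (odd j).
case: ifP => _; last by rewrite mxE.
by rewrite mxE !oddE; case: (odd i); case: (odd j); rewrite /= ?expr0 ?expr1 ?mulr1 ?mulrN1 ?opprK.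
Qed.

Variables (I J : finType).

(** The nonzero entry only shows that something is left to split off: a pair of rows with equal
    support is sought in all of [W], so the component found may avoid [i0] and [j0]. *)
Lemma block_component (W : I -> J -> R[i]) i0 j0 : weighing4 W -> W i0 j0 != 0 ->
  exists (b : uw_block R) M f g u v, [/\ block_ok b, nonzero_lines (block_size b) M,
    forall i j, block_matrix b i j = M i j & summand W (block_size b) M f g u v].
Proof.
move=> wW W0.
have [/existsP[p /existsP[q /and3P[pq /existsP[j pj] /forallP sub]]]|none] :=
  boolP [exists p, exists q, [&& p != q, [exists j, W p j != 0] &
    [forall j, (W p j != 0) ==> (W q j != 0)]]].
  have sub' j' : W p j' != 0 -> W q j' != 0 by apply/implyP/sub.
  have [m [x [f [g [u [v [m1 x1 sm]]]]]]] := E_component wW pq pj sub'.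
  exists (BE m x), (E_entry m x), f, g, u, v; split=> //.
  - by rewrite /= m1 /unimodular x1 eqxx.
  - exact: E_nonzero_lines.
  - by move=> i j'; apply: E_matrix_entry.
have no4 p q j : p != q -> W p j != 0 -> ~ (forall j, W p j != 0 -> W q j != 0).
  move=> pq pj sub; case/negP: none; apply/existsP; exists p; apply/existsP; exists q.
  rewrite pq /=; apply/andP; split; first by apply/existsP; exists j.
  by apply/forallP => j'; apply/implyP/sub.
have [T [f [g [u [v [Tin sm]]]]]] := sporadic_component omega_root wW no4 W0.
have [b [bok bs bE]] := sporadic_block Tin.
exists b, (fun i j => eis_val (omega R) (eis_entry T i j)), f, g, u, v.
split=> //; rewrite bs //; exact: sporadic_nonzero_lines omega_root Tin.
Qed.

(* Blocks are numbered from 0, and f a x is the row of W that carries row x of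
   block a. *)
Record decomposition (W : I -> J -> R[i]) (k : nat) (b : nat -> uw_block R)
    (f : nat -> nat -> I) (g : nat -> nat -> J) (u v : nat -> nat -> R[i]) : Prop :=
Decomposition {
  dc_ok : forall a, (a < k)%N -> block_ok (b a);
  dc_inj_row : forall a a' x x', (a < k)%N -> (a' < k)%N -> (x < block_size (b a))%N ->
    (x' < block_size (b a'))%N -> f a x = f a' x' -> a = a' /\ x = x';
  dc_inj_col : forall a a' x x', (a < k)%N -> (a' < k)%N -> (x < block_size (b a))%N ->
    (x' < block_size (b a'))%N -> g a x = g a' x' -> a = a' /\ x = x';
  dc_unit_row : forall a x, (a < k)%N -> (x < block_size (b a))%N -> `|u a x| = 1;
  dc_unit_col : forall a x, (a < k)%N -> (x < block_size (b a))%N -> `|v a x| = 1;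
  dc_entry : forall a (x y : 'I_(block_size (b a))), (a < k)%N ->
    W (f a x) (g a y) = u a x * v a y * block_matrix (b a) x y;
  dc_off : forall a a' x y, (a < k)%N -> (a' < k)%N -> a != a' ->
    (x < block_size (b a))%N -> (y < block_size (b a'))%N -> W (f a x) (g a' y) = 0;
  dc_row_nz : forall a x, (a < k)%N -> (x < block_size (b a))%N ->
    exists j, W (f a x) j != 0;
  dc_col_nz : forall a y, (a < k)%N -> (y < block_size (b a))%N ->
    exists i, W i (g a y) != 0;
  dc_row_cover : forall i j, W i j != 0 ->
    exists a x, [/\ (a < k)%N, (x < block_size (b a))%N & i = f a x] }.

(** Applied to a block of size [2m], this is the bound [m <= n / 2]. *)
Lemma decomposition_size_le (W : I -> J -> R[i]) k b f g u v a :
  decomposition W k b f g u v -> (a < k)%N -> (block_size (b a) <= #|I|)%N.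
Proof.
move=> dc ak; rewrite -[leqLHS]card_ord.
apply: (leq_card (fun x : 'I_(block_size (b a)) => f a x)) => x x' fE.
by have [_ xx] := dc_inj_row dc ak ak (ltn_ord x) (ltn_ord x') fE; apply: val_inj.
Qed.

Definition seq_cons (T : Type) (x : T) (s : nat -> T) (a : nat) : T :=
  if a is a'.+1 then s a' else x.

Lemma decomposition_cons (W : I -> J -> R[i]) b0 M f0 g0 u0 v0 k b f g u v :
  block_ok b0 -> nonzero_lines (block_size b0) M ->
  (forall i j, block_matrix b0 i j = M i j) ->
  summand W (block_size b0) M f0 g0 u0 v0 ->
  decomposition (peel W (block_size b0) f0) k b f g u v ->
  decomposition W k.+1 (seq_cons b0 b) (seq_cons f0 f) (seq_cons g0 g)
    (seq_cons u0 u) (seq_cons v0 v).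
Proof.
move=> ok0 [Mr Mc] bM sm dc.
have row_new a x : (a < k)%N -> (x < block_size (b a))%N ->
    forall x', (x' < block_size b0)%N -> f a x <> f0 x'.
  move=> ak xb; have [j nz] := dc_row_nz dc ak xb; exact: peel_row_neq nz.
have col_new a x : (a < k)%N -> (x < block_size (b a))%N ->
    forall x', (x' < block_size b0)%N -> g a x <> g0 x'.
  move=> ak xb; have [i nz] := dc_col_nz dc ak xb; exact: (peel_col_neq sm nz).
have unit0 (z : R[i]) : `|z| = 1 -> z != 0 by apply: unimod_neq0.
split.
- by case=> [|a] //= ak; apply: (dc_ok dc).
- case=> [|a] [|a'] x x' //= ak ak' xb xb' e.
  + by split=> //; apply: (sm_inj_row sm).
  + by case: (row_new _ _ ak' xb' _ xb).
  + by case: (row_new _ _ ak xb _ xb').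
  + by have [-> ->] := dc_inj_row dc ak ak' xb xb' e.
- case=> [|a] [|a'] x x' //= ak ak' xb xb' e.
  + by split=> //; apply: (sm_inj_col sm).
  + by case: (col_new _ _ ak' xb' _ xb).
  + by case: (col_new _ _ ak xb _ xb').
  + by have [-> ->] := dc_inj_col dc ak ak' xb xb' e.
- by case=> [|a] x /= ak xb; [apply: (sm_unit_row sm) | apply: (dc_unit_row dc)].
- by case=> [|a] x /= ak xb; [apply: (sm_unit_col sm) | apply: (dc_unit_col dc)].
- case=> [|a] /= x y ak; first by rewrite (sm_entry sm) // bM.
  rewrite -(dc_entry dc) //; apply/esym/peel_eq_row; exact: row_new.
- case=> [|a] [|a'] x y //= ak ak' aa' xb yb.
  + apply/eqP; apply: contraT => /(sm_row_closed sm xb)[z zb gE].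
    by case: (col_new _ _ ak' yb _ zb).
  + apply/eqP; apply: contraT => /(sm_col_closed sm yb)[z zb gE].
    by case: (row_new _ _ ak xb _ zb).
  + by rewrite -(dc_off dc ak ak' aa' xb yb); apply/esym/peel_eq_row/row_new.
- case=> [|a] x /= ak xb.
    have [y yb nz] := Mr x xb; exists (g0 y); rewrite (sm_entry sm) // !mulf_neq0 //;
    by apply: unit0; rewrite ?(sm_unit_row sm) ?(sm_unit_col sm).
  by have [j nz] := dc_row_nz dc ak xb; exists j; rewrite -(peel_eq nz).
- case=> [|a] y /= ak yb.
    have [x xb nz] := Mc y yb; exists (f0 x); rewrite (sm_entry sm) // !mulf_neq0 //;
    by apply: unit0; rewrite ?(sm_unit_row sm) ?(sm_unit_col sm).
  by have [i nz] := dc_col_nz dc ak yb; exists i; rewrite -(peel_eq nz).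
move=> i j Wij; have [p0|pij] := eqVneq (peel W (block_size b0) f0 i j) 0.
  move: p0 Wij; rewrite /peel; case: ifP => [/mapP[x] + -> _ _|_ ->]; last by rewrite eqxx.
  by rewrite mem_iota => /= xb; exists 0%N, x.
by have [a [x [ak xb ->]]] := dc_row_cover dc pij; exists a.+1, x.
Qed.

(** Induction on the number of nonzero rows, which drops because row [f0 0] of the split-off block
    becomes zero. *)
Lemma decomposition_exists (r0 : I) (c0 : J) (W : I -> J -> R[i]) : weighing4 W ->
  exists k b f g u v, decomposition W k b f g u v.
Proof.
have [n] := ubnP #|[pred i | [exists j, W i j != 0]]|.
elim: n W => // n IH W; rewrite ltnS => Wn wW.
have [/existsP[i0 /existsP[j0 W0]]|/existsPn none] := boolP [exists i, exists j, W i j != 0].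
  have [b0 [M [f0 [g0 [u0 [v0 [ok0 nz0 bM sm]]]]]]] := block_component wW W0.
  have [||k [b [f [g [u [v dc]]]]]] := IH (peel W (block_size b0) f0).
  - apply: leq_trans Wn; apply: proper_card; apply/properP; split.
      apply/subsetP => i; rewrite !inE => /existsP[j nz]; apply/existsP; exists j.
      by rewrite -(peel_eq nz).
    have sz0 : (0 < block_size b0)%N by case: (b0) ok0 => //= m x /andP[]; lia.
    have [y yb nz] := nz0.1 0%N sz0; exists (f0 0%N); rewrite inE.
      apply/existsP; exists (g0 y); rewrite (sm_entry sm) // !mulf_neq0 //;
      by apply: unimod_neq0; rewrite ?(sm_unit_row sm) ?(sm_unit_col sm).
    by apply/existsPn => j; apply/negP => /peel_row_neq/(_ 0%N sz0).
  - exact: weighing4_peel sm.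
  by do 6!eexists; apply: decomposition_cons sm dc.
(* The zero matrix has no blocks; the families are arbitrary defaults. *)
exists 0%N, (fun=> BW5 R), (fun _ _ => r0), (fun _ _ => c0), (fun _ _ => 0), (fun _ _ => 0).
by split=> // i j Wij; have /existsPn/(_ j) := none i; rewrite Wij.
Qed.

End Blocks.

(** * From decompositions to equivalence of matrices *)

Section Matrices.

Variables (R : realType) (n : nat).

(** A right inverse of a square matrix is a left inverse, so the columns are orthogonal as well. The
    diagonal entries 4 count the nonzero entries of each line. *)
Lemma unit_weighing4_square (W : 'M[R[i]]_n) : unit_weighing 4 W -> weighing4 W.
Proof.
case=> ent WW.
have four0 : (4%:R : R[i]) != 0 by rewrite pnatr_eq0.
have WW' : (W ^t*)%sesqui *m W = 4%:M.
  have : W *m (4^-1 *: (W ^t*)%sesqui) = 1%:M.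
    by rewrite -scalemxAr WW scale_scalar_mx mulVf.
  move/mulmx1C; rewrite -scalemxAl => H.
  by rewrite -[LHS](scalerKV four0) H scale_scalar_mx mulr1.
have norm1 i j : W i j != 0 -> `|W i j| = 1.
  by case: (ent i j) => [/eqP//|->]; rewrite eqxx.
have sq i j : W i j * (W i j)^* = (W i j != 0)%:R.
  by have [->|/norm1/unimod_mulJ//] := eqVneq (W i j) 0; rewrite mul0r.
have rowE i i' : \sum_j W i j * (W i' j)^* = 4 *+ (i == i').
  have /matrixP/(_ i i') := WW; rewrite !mxE => <-.
  by apply: eq_bigr => j _; rewrite !mxE.
have colE j j' : \sum_i W i j * (W i j')^* = 4 *+ (j == j').
  have /matrixP/(_ j' j) := WW'; rewrite !mxE eq_sym => <-.
  by apply: eq_bigr => i _; rewrite !mxE mulrC.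
have card4 (P : pred 'I_n) : \sum_i (P i)%:R = 4 :> R[i] -> #|P| = 4%N.
  rewrite -natr_sum => /eqP; rewrite eqr_nat => /eqP <-.
  by rewrite -sum1_card big_mkcond; apply: eq_bigr => i _; rewrite unfold_in; case: (P i).
split=> //.
- move=> i j _; apply: card4; have := rowE i i; rewrite eqxx mulr1n => <-.
  by apply: eq_bigr => j' _; rewrite sq.
- move=> i j _; apply: card4; have := colE j j; rewrite eqxx mulr1n => <-.
  by apply: eq_bigr => i' _; rewrite sq.
- by move=> i i' /negPf ii'; rewrite rowE ii'.
- by move=> j j' /negPf jj'; rewrite colE jj'.
Qed.

Lemma unit_weighing_row_neq0 (W : 'M[R[i]]_n) i : unit_weighing 4 W ->
  exists j, W i j != 0.
Proof.
case=> ent /matrixP/(_ i i); rewrite !mxE eqxx => WW.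
apply/existsP; apply: contraT => /existsPn none.
have : (4%:R : R[i]) = 0.
  rewrite -[LHS]WW big1 // => j _.
  by have := none j; rewrite negbK => /eqP->; rewrite mul0r.
by move/eqP; rewrite pnatr_eq0.
Qed.

Lemma uw_equiv_scale_rows (A B : 'M[R[i]]_n) (u : 'I_n -> R[i]) :
  (forall i, unimodular (u i)) -> uw_equiv A B -> uw_equiv A (\matrix_(i, j) (u i * B i j)).
Proof.
move=> u1 AB.
suff H (s : seq 'I_n) : uniq s ->
    uw_equiv A (\matrix_(i, j) ((if i \in s then u i else 1) * B i j)).
  have := H _ (enum_uniq 'I_n); congr uw_equiv; apply/matrixP => i j.
  by rewrite !mxE mem_enum.
elim: s => [_|k s IH /= /andP[ks /IH us]].
  by have -> : (\matrix_(i, j) ((if i \in [::] then u i else 1) * B i j)) = B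
    by apply/matrixP => i j; rewrite mxE mul1r.
have := uw_scale_row k (u1 k) us; congr uw_equiv; apply/matrixP => i j; rewrite !mxE inE.
by have [->|ik] := eqVneq i k; rewrite ?(negPf ks) mul1r.
Qed.

Lemma uw_equiv_scale_cols (A B : 'M[R[i]]_n) (v : 'I_n -> R[i]) :
  (forall j, unimodular (v j)) -> uw_equiv A B -> uw_equiv A (\matrix_(i, j) (B i j * v j)).
Proof.
move=> v1 AB.
suff H (s : seq 'I_n) : uniq s ->
    uw_equiv A (\matrix_(i, j) (B i j * (if j \in s then v j else 1))).
  have := H _ (enum_uniq 'I_n); congr uw_equiv; apply/matrixP => i j.
  by rewrite !mxE mem_enum.
elim: s => [_|k s IH /= /andP[ks /IH vs]].
  by have -> : (\matrix_(i, j) (B i j * (if j \in [::] then v j else 1))) = B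
    by apply/matrixP => i j; rewrite mxE mulr1.
have := uw_scale_col k (v1 k) vs; congr uw_equiv; apply/matrixP => i j; rewrite !mxE inE.
by have [->|jk] := eqVneq j k; rewrite ?(negPf ks) ?mulr1.
Qed.

(** Injective self-maps of ['I_n] are permutations; applying them and then dividing by the phases
    leads from [W] to [M]. *)
Lemma uw_equiv_monomial (W M : 'M[R[i]]_n) (F G : 'I_n -> 'I_n) (u v : 'I_n -> R[i]) :
  injective F -> injective G -> (forall i, `|u i| = 1) -> (forall j, `|v j| = 1) ->
  (forall i j, W (F i) (G j) = u i * v j * M i j) -> uw_equiv W M.
Proof.
move=> Finj Ginj u1 v1 WM.
have E0 : uw_equiv W (row_perm (perm Finj) (col_perm (perm Ginj) W)).
  by do 2!constructor; constructor.
have uV i : unimodular (u i)^-1 by rewrite /unimodular normfV u1 invr1.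
have vV j : unimodular (v j)^-1 by rewrite /unimodular normfV v1 invr1.
have := uw_equiv_scale_cols vV (uw_equiv_scale_rows uV E0).
congr uw_equiv; apply/matrixP => i j; rewrite !mxE !permE WM.
by field; rewrite !unimod_neq0.
Qed.

End Matrices.

Theorem mainTheorem1 (R : realType) (n : nat) (W : 'M[R[i]]_n) :
  (1 <= n)%N ->
  unit_weighing 4 W ->
  exists (k : nat) (b : 'I_k -> uw_block R)
         (e : (\sum_(i < k) block_size (b i) = n)%N),
    (forall i, block_admissible n (b i)) /\
    uw_equiv W (castmx (e, e) (\mxdiag_(i < k) block_matrix (b i))).
Proof.
move=> n_gt0 uwW; have wW := unit_weighing4_square uwW.
pose i0 := Ordinal n_gt0.
have [k [b [f [g [u [v dc]]]]]] := decomposition_exists i0 i0 wW.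
(* [tagnat] splits an index of the block diagonal matrix into the block number [S1] and the position
   [S2] in that block. *)
pose B (i : 'I_k) := b i; pose N := (\sum_(i < k) block_size (B i))%N.
pose S1 (t : 'I_N) : 'I_k := tagnat.sig1 t.
pose S2 (t : 'I_N) : 'I_(block_size (B (S1 t))) := tagnat.sig2 t.
have S_inj t t' : S1 t = S1 t' :> nat -> S2 t = S2 t' :> nat -> t = t'.
  move=> /val_inj/eqP e1 /eqP e2; apply: val_inj; apply/eqP.
  by rewrite -[t]tagnat.sig2K -[t']tagnat.sig2K tagnat.eq_Rank e1.
pose F t := f (S1 t) (S2 t); pose G t := g (S1 t) (S2 t).
have F_inj : injective F.
  move=> t t' /(dc_inj_row dc)[] //; exact: S_inj.
have G_inj : injective G.
  move=> t t' /(dc_inj_col dc)[] //; exact: S_inj.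
(* No row of [W] is zero, so every row belongs to some block. *)
have F_onto i : exists t, F t == i.
  have [j Wij] := unit_weighing_row_neq0 i uwW.
  have [a [x [ak xb ->]]] := dc_row_cover dc Wij.
  pose t : 'I_N := @tagnat.Rank _ (fun i => block_size (B i)) (Ordinal ak) (Ordinal xb).
  have e1 : S1 t = a :> nat by rewrite /S1 tagnat.Rank1K.
  have e2 : S2 t = x :> nat by rewrite /S2 tagnat.Rank2K.
  by exists t; rewrite /F e1 e2.
(* [F] and a section of it are injective, which gives both inequalities; the injective [G] then
   exhausts the columns too. *)
have eN : N = n.
  have le1 := leq_card F F_inj.
  have h_inj : injective (fun i => xchoose (F_onto i)).
    by move=> i i' e; rewrite -(eqP (xchooseP (F_onto i))) e (eqP (xchooseP (F_onto i'))).
  by have := leq_card _ h_inj; move: le1; rewrite !card_ord => le1 le2;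
    apply/eqP; rewrite eqn_leq le1.
exists k, B, eN; split.
  move=> i; have := dc_ok dc (ltn_ord i); have := decomposition_size_le dc (ltn_ord i).
  rewrite card_ord /B; case: (b i) => //= m x mn /andP[-> ->]; rewrite andbT; lia.
(* The last factor has the shape to which [\mxdiag] unfolds. *)
have entry (p q : 'I_k) (x : 'I_(block_size (B p))) (y : 'I_(block_size (B q))) :
    W (f p x) (g q y) = u p x * v q y *
      (if p == q then conform_mx 0 (block_matrix (B p)) else 0 : 'M_(_, _)) x y.
  case: eqVneq => [pq|pq]; last by rewrite mxE mulr0 (dc_off dc).
  by case: _ / pq in y *; rewrite conform_mx_id (dc_entry dc).
apply: (@uw_equiv_monomial _ _ _ _ (F \o cast_ord (esym eN)) (G \o cast_ord (esym eN))
  (fun i => let t := cast_ord (esym eN) i in u (S1 t) (S2 t))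
  (fun i => let t := cast_ord (esym eN) i in v (S1 t) (S2 t))).
- by apply: inj_comp => //; apply: cast_ord_inj.
- by apply: inj_comp => //; apply: cast_ord_inj.
- by move=> i; apply: (dc_unit_row dc).
- by move=> i; apply: (dc_unit_col dc).
by move=> i j; rewrite castmxE /mxdiag mxE; apply: entry.
Qed.
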